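(* For every $X,Y\in\mathfrak n_{\mathbb F}$ there is $Z\in\mathfrak n_{\mathbb F}$ such that $\exp(X)\exp(Y)=\exp(Z)$; equivalently, for $u,v\in U_{\mathbb F}$ with $X=\log u$, $Y=\log v$, this holds with $Z=\log(uv)$. The element $Z$ is given by a finite sum of iterated commutators in $X$ and $Y$ (the terms of the Baker–Campbell–Hausdorff series), the first terms (those of bracket length at most $4$) of which are given by $$Z=X+Y+\tfrac12[X,Y]+\tfrac1{12}\big([X,[X,Y]]+[Y,[Y,X]]\big)-\tfrac1{24}[Y,[X,[X,Y]]]+\ldots$$
   Context: $\mathbb K,\mathbb F$ are real closed fields with $\mathbb K\subseteq\mathbb R\cap\mathbb F$, and $\mathbb D$ is an algebraically closed field containing $\mathbb R$ and $\mathbb F$. A linear algebraic group is a Zariski-closed subgroup of some $\mathrm{GL}_n(\mathbb D)$; it is semisimple if it is Zariski-connected and every closed connected normal abelian subgroup is trivial. $X_{\mathbb R}$ denotes the semialgebraic extension to $\mathbb R$ of a semialgebraic set $X\subseteq\mathbb K^m$ (the subset of $\mathbb R^m$ defined by the same first-order formula of ordered fields with parameters in $\mathbb K$). $\mathbf G<\mathrm{GL}_n(\mathbb D)$ is a semisimple linear algebraic group defined over $\mathbb K$ which is self-adjoint ($g\in\mathbf G\Rightarrow g^{\mathsf T}\in\mathbf G$). $G$ is a semialgebraic group with $\mathbf G(\mathbb K)^\circ<G<\mathbf G(\mathbb K)$, where $\mathbf G(\mathbb K)^\circ$ is the semialgebraic connected component of the identity. $\mathbf S$ is a self-adjoint maximal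 $\mathbb K$-split torus of $\mathbf G$, and $A$ is the semialgebraic connected component of the identity of $\mathbf S(\mathbb K)$. $\mathfrak g_{\mathbb R}=\mathrm{Lie}(G_{\mathbb R})$ and $\mathfrak a=\mathrm{Lie}(A_{\mathbb R})$. For $\alpha\in\mathfrak a^\star$ put $\mathfrak g_\alpha=\{X\in\mathfrak g_{\mathbb R}: [H,X]=\alpha(H)X\ \forall H\in\mathfrak a\}$, and $\Sigma=\{\alpha\in\mathfrak a^\star\setminus\{0\}:\mathfrak g_\alpha\neq0\}$, a root system; a set of positive roots $\Sigma_{>0}$ is fixed. Each $\mathfrak g_\alpha$ is spanned by $\mathfrak g_\alpha\cap\mathbb K^{n\times n}$, and $(\mathfrak g_\alpha)_{\mathbb F}$ denotes the $\mathbb F$-span of this $\mathbb K$-vector space. $\mathfrak n_{\mathbb F}=\bigoplus_{\alpha\in\Sigma_{>0}}(\mathfrak g_\alpha)_{\mathbb F}$, which consists of nilpotent matrices, and $U_{\mathbb F}=\exp(\mathfrak n_{\mathbb F})$; $\exp$ and $\log$ between $\mathfrak n_{\mathbb F}$ and $U_{\mathbb F}$ are polynomial maps. The Baker–Campbell–Hausdorff series is the formal series $\log(e^Xe^Y)$ expressed as a rational-coefficient combination of iterated commutators of $X,Y$; on $\mathfrak n_{\mathbb F}$ only finitely many terms are nonzero. *)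

(* Defs.v *)
From mathcomp Require Import all_boot all_order all_algebra.
(* The notations of mpoly clash with those of the files imported next. *)
From mathcomp Require Import -(notations) mpoly.
From mathcomp Require Import boolp classical_sets reals topology normedtype.
From mathcomp Require Import derive.
From mathcomp Require ordered_qelim.

Set Implicit Arguments.
Unset Strict Implicit.
Unset Printing Implicit Defensive.

Import Order.TTheory GRing.Theory Num.Theory numFieldNormedType.Exports.

Local Open Scope classical_set_scope.
Local Open Scope ring_scope.

(* Polynomials in the n * n matrix entries. *)
Definition mxpol (L : comNzRingType) (n : nat) := mpoly (n * n) L.

Definition mxeval (L : comNzRingType) n (p : mxpol L n) (g : 'M[L]_n) : L :=
  meval (fun i => mxvec g 0 i) p.

Definition vanishes_on (L : comNzRingType) n (p : mxpol L n)
    (E : set 'M[L]_n) : Prop :=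
  forall g, E g -> mxeval p g = 0.

Definition matrix_group (L : fieldType) n (E : set 'M[L]_n) : Prop :=
  [/\ forall g, E g -> g \in unitmx,
      E 1%:M,
      forall g h, E g -> E h -> E (g *m h)
    & forall g, E g -> E (invmx g)].

(* Closed subsets of GL_n, not of the affine space of all matrices. *)
Definition zariski_closed (L : fieldType) n (E : set 'M[L]_n) : Prop :=
  exists P : set (mxpol L n),
    E = [set g | g \in unitmx /\ forall p, P p -> mxeval p g = 0].

Definition linear_algebraic_group (L : fieldType) n (E : set 'M[L]_n) : Prop :=
  matrix_group E /\ zariski_closed E.

Definition zariski_connected (L : fieldType) n (E : set 'M[L]_n) : Prop :=
  forall C1 C2 : set 'M[L]_n, zariski_closed C1 -> zariski_closed C2 ->
    E `<=` C1 `|` C2 -> E `&` (C1 `&` C2) = set0 -> E `<=` C1 \/ E `<=` C2.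

Definition semisimple (L : fieldType) n (E : set 'M[L]_n) : Prop :=
  zariski_connected E /\
  forall N : set 'M[L]_n,
    linear_algebraic_group N -> zariski_connected N -> N `<=` E ->
    (forall g h, E g -> N h -> N (g *m h *m invmx g)) ->
    (forall h k, N h -> N k -> h *m k = k *m h) ->
    N = [set 1%:M].

Definition self_adjoint (L : fieldType) n (E : set 'M[L]_n) : Prop :=
  forall g, E g -> E g^T.

(* The vanishing ideal of E is generated by polynomials over K. *)
Definition defined_over (K D : fieldType) (iota : {rmorphism K -> D}) n
    (E : set 'M[D]_n) : Prop :=
  forall p : mxpol D n, vanishes_on p E ->
    exists2 s : seq (mxpol D n * mxpol K n),
      forall t, t \in s -> vanishes_on (map_mpoly iota t.2) E
    & p = \sum_(t <- s) t.1 * map_mpoly iota t.2.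

Definition points (K D : fieldType) (iota : {rmorphism K -> D}) n
    (E : set 'M[D]_n) : set 'M[K]_n :=
  [set g | E (map_mx iota g)].

(* Maps whose coordinates are K-regular functions on GL_n, i.e. elements of
   K[x_ij, 1/det], restricted to E. *)
Definition regular_over (K D : fieldType) (iota : {rmorphism K -> D}) n m
    (E : set 'M[D]_n) (f : 'M[D]_n -> 'M[D]_m) : Prop :=
  exists (p : 'I_m -> 'I_m -> mxpol K n) (k : nat), forall g, E g ->
    f g = \matrix_(i, j)
            (mxeval (map_mpoly iota (p i j)) g / (\det g) ^+ k).

Definition isomorphic_over (K D : fieldType) (iota : {rmorphism K -> D}) n m
    (E : set 'M[D]_n) (E' : set 'M[D]_m) : Prop :=
  exists (f : 'M[D]_n -> 'M[D]_m) (h : 'M[D]_m -> 'M[D]_n),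
    [/\ regular_over iota E f /\ regular_over iota E' h,
        (forall x, E x -> E' (f x)) /\ (forall y, E' y -> E (h y)),
        (forall x, E x -> h (f x) = x) /\ (forall y, E' y -> f (h y) = y)
      & forall x y, E x -> E y -> f (x *m y) = f x *m f y].

Definition diagonal_torus (D : fieldType) d : set 'M[D]_d :=
  [set g | g \in unitmx /\ is_diag_mx g].

Definition split_torus (K D : fieldType) (iota : {rmorphism K -> D}) n
    (S : set 'M[D]_n) : Prop :=
  [/\ linear_algebraic_group S, defined_over iota S
    & exists d, isomorphic_over iota S (@diagonal_torus D d)].

Definition maximal_split_torus (K D : fieldType) (iota : {rmorphism K -> D}) n
    (E S : set 'M[D]_n) : Prop :=
  [/\ split_torus iota S, S `<=` E
    & forall T, split_torus iota T -> T `<=` E -> S `<=` T -> T = S].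

Section MapFormula.
Variables (K R : Type) (f : K -> R).

Fixpoint map_term (t : GRing.term K) : GRing.term R :=
  match t with
  | GRing.Var i => GRing.Var R i
  | GRing.Const c => GRing.Const (f c)
  | GRing.NatConst k => GRing.NatConst R k
  | GRing.Add u v => GRing.Add (map_term u) (map_term v)
  | GRing.Opp u => GRing.Opp (map_term u)
  | GRing.NatMul u k => GRing.NatMul (map_term u) k
  | GRing.Mul u v => GRing.Mul (map_term u) (map_term v)
  | GRing.Inv u => GRing.Inv (map_term u)
  | GRing.Exp u k => GRing.Exp (map_term u) k
  end.

Import ordered_qelim.ord.

Fixpoint map_formula (phi : formula K) : formula R :=
  match phi with
  | Bool b => Bool b
  | Equal u v => Equal (map_term u) (map_term v)
  | Lt u v => Lt (map_term u) (map_term v)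
  | Le u v => Le (map_term u) (map_term v)
  | Unit u => Unit (map_term u)
  | And p q => And (map_formula p) (map_formula q)
  | Or p q => Or (map_formula p) (map_formula q)
  | Implies p q => Implies (map_formula p) (map_formula q)
  | Not p => Not (map_formula p)
  | Exists i p => Exists i (map_formula p)
  | Forall i p => Forall i (map_formula p)
  end.

End MapFormula.

(* The n * n first variables of a formula stand for the entries of g; the
   other ones are interpreted by 0 when they occur free.  Besides the language
   of ordered fields, formulas may use the definable inverse, with 0^-1 = 0. *)
Definition mxholds (K : realDomainType) n (phi : ordered_qelim.ord.formula K)
    (g : 'M[K]_n) : Prop :=
  ordered_qelim.ord.holds [seq mxvec g 0 i | i <- enum 'I_(n * n)] phi.

Definition semialgebraic (K : rcfType) n (E : set 'M[K]_n) : Prop :=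
  exists phi, E = [set g | mxholds phi g].

(* The extension of a semialgebraic set; by the Tarski transfer principle it
   does not depend on the formula phi defining E. *)
Definition sa_extension (K R : rcfType) (iota : {rmorphism K -> R}) n
    (E : set 'M[K]_n) : set 'M[R]_n :=
  [set g | exists2 phi, E = [set h | mxholds phi h]
                      & mxholds (map_formula iota phi) g].

Definition relatively_open (K : rcfType) n (E U : set 'M[K]_n) : Prop :=
  U `<=` E /\
  forall g, U g -> exists2 e : K, 0 < e &
    forall h, E h -> (forall i j, `|h i j - g i j| < e) -> U h.

Definition sa_connected (K : rcfType) n (E : set 'M[K]_n) : Prop :=
  forall U V : set 'M[K]_n, semialgebraic U -> semialgebraic V ->
    relatively_open E U -> relatively_open E V ->
    U `|` V = E -> U `&` V = set0 -> U = set0 \/ V = set0.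

Definition sa_identity_component (K : rcfType) n (E : set 'M[K]_n) :
    set 'M[K]_n :=
  [set g | exists C : set 'M[K]_n,
    [/\ semialgebraic C, C `<=` E, sa_connected C, C 1%:M & C g]].

Definition lie_bracket (L : fieldType) n (X Y : 'M[L]_n) : 'M[L]_n :=
  X *m Y - Y *m X.

(* The tangent space at the identity of a closed subgroup E of GL_n(R): the
   initial velocities of differentiable curves in E.  Since a closed subgroup
   is a submanifold, requiring more smoothness gives the same space. *)
Definition is_lie_algebra (R : realType) n (E : set 'M[R]_n)
    (g : {vspace 'M[R]_n}) : Prop :=
  forall X, X \in g <->
    exists c : R -> 'M[R]_n,
      [/\ forall t, E (c t), c 0 = 1%:M,
          forall t i j, derivable (fun s : R => c s i j) t 1
        & forall i j, derive1 (fun s : R => c s i j) 0 = X i j].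

Section Roots.
Variables (R : realType) (n : nat) (g a : {vspace 'M[R]_n}).

Definition dual_space := 'Hom(subvs_of a, R^o).

Definition root_space (alpha : dual_space) : set 'M[R]_n :=
  [set X | X \in g /\
    forall H : subvs_of a, lie_bracket (vsval H) X = (alpha H : R) *: X].

Definition is_root : set dual_space :=
  [set alpha | alpha != 0 /\ exists2 X, root_space alpha X & X != 0].

Definition nonneg_combination (Delta : seq dual_space) (alpha : dual_space) :
    Prop :=
  exists c : nat -> nat, alpha = \sum_(i < size Delta) Delta`_i *+ c i.

(* A basis of the root system Sigma (simple roots); the positive roots are
   those with nonnegative coordinates. *)
Definition root_basis (Sigma : set dual_space) (Delta : seq dual_space) :
    Prop :=
  [/\ forall alpha, alpha \in Delta -> Sigma alpha,
      basis_of fullv Delta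
    & forall alpha, Sigma alpha ->
        nonneg_combination Delta alpha \/ nonneg_combination Delta (- alpha)].

Definition positive_system (Sigma P : set dual_space) : Prop :=
  exists2 Delta, root_basis Sigma Delta
    & P = [set alpha | Sigma alpha /\ nonneg_combination Delta alpha].

Variables (K F : rcfType).
Variables (iKR : {rmorphism K -> R}) (iKF : {rmorphism K -> F}).

(* The F-span of the K-rational points of a root space. *)
Definition root_space_over (alpha : dual_space) : set 'M[F]_n :=
  [set X | exists2 s : seq (F * 'M[K]_n),
    forall t, t \in s -> root_space alpha (map_mx iKR t.2)
    & X = \sum_(t <- s) t.1 *: map_mx iKF t.2].

(* The sum of the root spaces of P; it is direct since root spaces of distinct
   roots are independent. *)
Definition nilradical_over (P : set dual_space) : set 'M[F]_n :=
  [set X | exists (s : seq dual_space) (Z : dual_space -> 'M[F]_n),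
    [/\ uniq s,
        forall alpha, alpha \in s -> P alpha /\ root_space_over alpha (Z alpha)
      & X = \sum_(alpha <- s) Z alpha]].

End Roots.

(* Exponential of a nilpotent X, resp. logarithm of a unipotent u: the terms
   of degree at least n of the series vanish, as N ^+ n = 0 for N nilpotent. *)
Definition nilp_exp (L : fieldType) n (X : 'M[L]_n) : 'M[L]_n :=
  \sum_(k < n) (k`!%:R)^-1 *: X ^+ k.

Definition unip_log (L : fieldType) n (u : 'M[L]_n) : 'M[L]_n :=
  \sum_(1 <= k < n) ((-1) ^+ k.+1 / k%:R) *: (u - 1%:M) ^+ k.

(* Noncommutative formal power series over rat in two variables, as functions
   from words to coefficients; the letter [false] is X and [true] is Y. *)
Definition ncseries := seq bool -> rat.

Definition nc_var (b : bool) : ncseries := fun w => (w == [:: b])%:R.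

Definition nc_one : ncseries := fun w => (w == [::])%:R.

Definition nc_sub (f g : ncseries) : ncseries := fun w => f w - g w.

Definition nc_mul (f g : ncseries) : ncseries :=
  fun w => \sum_(i < (size w).+1) f (take i w) * g (drop i w).

Definition nc_pow (f : ncseries) (k : nat) : ncseries :=
  iter k (nc_mul f) nc_one.

(* If f has no constant term, then f ^ k has no term of degree less than k, so
   the sums below can stop at the length of the word. *)
Definition nc_exp (f : ncseries) : ncseries :=
  fun w => \sum_(k < (size w).+1) nc_pow f k w / k`!%:R.

Definition nc_log (f : ncseries) : ncseries :=
  fun w => \sum_(1 <= k < (size w).+1)
    (-1) ^+ k.+1 / k%:R * nc_pow (nc_sub f nc_one) k w.

Definition bch_series : ncseries :=
  nc_log (nc_mul (nc_exp (nc_var false)) (nc_exp (nc_var true))).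

Inductive commutator : Type :=
| CX
| CY
| CBracket of commutator & commutator.

Fixpoint commutator_length (c : commutator) : nat :=
  match c with
  | CX | CY => 1
  | CBracket c d => commutator_length c + commutator_length d
  end.

Fixpoint commutator_eval (V : Type) (br : V -> V -> V) (x y : V)
    (c : commutator) : V :=
  match c with
  | CX => x
  | CY => y
  | CBracket c d => br (commutator_eval br x y c) (commutator_eval br x y d)
  end.

Definition nc_bracket (f g : ncseries) : ncseries :=
  nc_sub (nc_mul f g) (nc_mul g f).

(* B m is the homogeneous part of degree m of the series, written as a formal
   rational combination of iterated commutators of length m.  Only B (size w)
   contributes to the coefficient of a word w. *)
Definition bch_expression (B : nat -> seq (rat * commutator)) : Prop :=
  (forall m, all (fun t => commutator_length t.2 == m) (B m)) /\
  forall w : seq bool,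
    bch_series w =
    \sum_(t <- B (size w)) t.1 *
      commutator_eval nc_bracket (nc_var false) (nc_var true) t.2 w.

Definition bch_first_terms (B : nat -> seq (rat * commutator)) : Prop :=
  let XY := CBracket CX CY in
  [/\ B 1%N = [:: (1, CX); (1, CY)],
      B 2%N = [:: (2^-1, XY)],
      B 3%N = [:: (12^-1, CBracket CX XY);
                  (12^-1, CBracket CY (CBracket CY CX))]
    & B 4%N = [:: (- 24^-1, CBracket CY (CBracket CX XY))]].

Definition commutator_mx (L : fieldType) n (X Y : 'M[L]_n) (c : commutator) :
    'M[L]_n :=
  commutator_eval (@lie_bracket L n) X Y c.

(* Z is the sum of the series B at (X, Y), all but finitely many of whose
   terms vanish. *)
Definition bch_sum (B : nat -> seq (rat * commutator)) (L : fieldType) n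
    (X Y Z : 'M[L]_n) : Prop :=
  exists2 N : nat,
    forall m, (N < m)%N -> all (fun t => commutator_mx X Y t.2 == 0) (B m)
  & Z = X + Y + 2^-1 *: lie_bracket X Y
      + 12^-1 *: (lie_bracket X (lie_bracket X Y)
                  + lie_bracket Y (lie_bracket Y X))
      - 24^-1 *: lie_bracket Y (lie_bracket X (lie_bracket X Y))
      + \sum_(5 <= m < N.+1) \sum_(t <- B m) ratr t.1 *: commutator_mx X Y t.2.

(* Main.v *)
Require Import Defs.
From HB Require Import structures.
From mathcomp Require Import all_boot all_order all_algebra.
From mathcomp Require Import boolp classical_sets reals topology normedtype.
From mathcomp Require Import derive ring.
From mathcomp Require ordered_qelim.

(** The series Z = log (exp X exp Y) lives in the algebra of noncommutative
    formal power series over the rationals.  Let E be the Euler derivation,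
    which multiplies the homogeneous part of degree m by m.  Since E X = X and
    E Y = Y, applying E to exp Z = exp X exp Y gives
      E (exp Z) = X exp Z + exp Z Y.
    Conjugation by an exponential and the differential of the exponential are
    power series in ad Z, so dividing by exp Z on the left turns this into
      sum_k (-1)^k / (k + 1)! (ad Z)^k (E Z)
        = sum_k (-1)^k / k! (ad Z)^k X + Y
    (lemma [bch_equation]).  In degree m the left-hand side is m Z_m plus
    iterated brackets of parts of Z of degrees less than m, so that Z_m is a
    Lie polynomial by induction on m ([lie_hom_bch]).  In degrees at most 4 the
    announced expression is compared with Z word by word ([bch_low_terms]).

    If all long products of two matrices X and Y vanish, evaluating series at
    (X, Y) is a ring morphism ([evM]), which carries the formal identities
    between exp, log and Z to matrices.  What remains is that n_F is closed
    under brackets and that long products of its elements vanish.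

    For the second point, choose H in a at which all the simple roots take the
    value 1.  A product of k root vectors of positive roots is then either 0 or
    an eigenvector of ad H whose eigenvalue is an integer at least k, and ad H
    has finitely many eigenvalues ([root_vector_prod0]).

    The first point reduces to the same property of g, as the bracket of
    vectors of weights alpha and beta has weight alpha + beta.  Here g is the
    set of velocities at 1 of the curves in the semialgebraic extension of G,
    which is stable under conjugation: if phi1 and phi2 are formulas defining
    G, then the formula in z saying that z x = x y for some x satisfying phi1
    and some y satisfying phi2 defines G as well ([sa_extension_conj]).  For a
    curve c with velocity X and for Y in g, the curve c(t) Y adj(c(t)) remains
    in g for t near 0, because adj(c(t)) is a multiple of the inverse of c(t);
    its velocity is [X, Y] plus a multiple of Y ([is_lie_algebra_bracket]). *)

Set Implicit Arguments.
Unset Strict Implicit.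
Unset Printing Implicit Defensive.

Import Order.TTheory GRing.Theory Num.Theory numFieldNormedType.Exports.

Local Open Scope classical_set_scope.
Local Open Scope ring_scope.

(** * The algebra of noncommutative power series *)

(** A copy of [ncseries], to carry the convolution product rather than any
    pointwise structure on functions. *)
Definition ncs : Type := ncseries.

HB.instance Definition _ := gen_eqMixin ncs.
HB.instance Definition _ := gen_choiceMixin ncs.

Lemma ncs_ext (f g : ncs) : (forall w, f w = g w) -> f = g.
Proof. by move=> fg; apply/funext. Qed.

Definition ncs_zero : ncs := fun=> 0.
Definition ncs_opp (f : ncs) : ncs := fun w => - f w.
Definition ncs_add (f g : ncs) : ncs := fun w => f w + g w.
Definition ncs_scale (a : rat) (f : ncs) : ncs := fun w => a * f w.

Lemma ncs_addA : associative ncs_add.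
Proof. by move=> f g h; apply: ncs_ext => w; apply: addrA. Qed.

Lemma ncs_addC : commutative ncs_add.
Proof. by move=> f g; apply: ncs_ext => w; apply: addrC. Qed.

Lemma ncs_add0 : left_id ncs_zero ncs_add.
Proof. by move=> f; apply: ncs_ext => w; apply: add0r. Qed.

Lemma ncs_addN : left_inverse ncs_zero ncs_opp ncs_add.
Proof. by move=> f; apply: ncs_ext => w; apply: addNr. Qed.

HB.instance Definition _ := GRing.isZmodule.Build ncs
  ncs_addA ncs_addC ncs_add0 ncs_addN.

Lemma ncs_scaleA a b f : ncs_scale a (ncs_scale b f) = ncs_scale (a * b) f.
Proof. by apply: ncs_ext => w; apply: mulrA. Qed.

Lemma ncs_scale1 : left_id 1 ncs_scale.
Proof. by move=> f; apply: ncs_ext => w; apply: mul1r. Qed.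

Lemma ncs_scaleDr : right_distributive ncs_scale +%R.
Proof. by move=> a f g; apply: ncs_ext => w; apply: mulrDr. Qed.

Lemma ncs_scaleDl (f : ncs) : {morph ncs_scale^~ f : a b / a + b}.
Proof. by move=> a b; apply: ncs_ext => w; apply: mulrDl. Qed.

HB.instance Definition _ := GRing.Zmodule_isLmodule.Build rat ncs
  ncs_scaleA ncs_scale1 ncs_scaleDr ncs_scaleDl.

(** The series f with f = f [::] + X * left_deriv false f
    + Y * left_deriv true f; it makes inductions on words possible. *)
Definition left_deriv (b : bool) (f : ncs) : ncs := fun w => f (b :: w).

Lemma ncs_addE (f g : ncs) w : (f + g) w = f w + g w.
Proof. by []. Qed.

Lemma ncs_oppE (f : ncs) w : (- f) w = - f w.
Proof. by []. Qed.

Lemma ncs_scaleE a (f : ncs) w : (a *: f) w = a * f w.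
Proof. by []. Qed.

Lemma nc_mul_nil f g : nc_mul f g [::] = f [::] * g [::].
Proof. by rewrite /nc_mul /= big_ord1. Qed.

Lemma nc_mul_cons f g b w :
  nc_mul f g (b :: w) = f [::] * g (b :: w) + nc_mul (left_deriv b f) g w.
Proof. by rewrite /nc_mul /= big_ord_recl. Qed.

Lemma nc_mulDl : left_distributive nc_mul (+%R : ncs -> ncs -> ncs).
Proof.
move=> f g h; apply: ncs_ext => w; rewrite /nc_mul !ncs_addE -big_split /=.
by apply: eq_bigr => i _; rewrite mulrDl.
Qed.

Lemma nc_mulDr : right_distributive nc_mul (+%R : ncs -> ncs -> ncs).
Proof.
move=> f g h; apply: ncs_ext => w; rewrite /nc_mul !ncs_addE -big_split /=.
by apply: eq_bigr => i _; rewrite mulrDr.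
Qed.

Lemma nc_mulZl a (f g : ncs) : nc_mul (a *: f) g = a *: (nc_mul f g : ncs).
Proof.
apply: ncs_ext => w; rewrite /nc_mul ncs_scaleE mulr_sumr.
by apply: eq_bigr => i _; rewrite ncs_scaleE mulrA.
Qed.

Lemma nc_mulZr a (f g : ncs) : nc_mul f (a *: g) = a *: (nc_mul f g : ncs).
Proof.
apply: ncs_ext => w; rewrite /nc_mul ncs_scaleE mulr_sumr.
by apply: eq_bigr => i _; rewrite ncs_scaleE mulrCA.
Qed.

Lemma left_deriv_mul b (f g : ncs) :
  left_deriv b (nc_mul f g)
  = f [::] *: left_deriv b g + (nc_mul (left_deriv b f) g : ncs).
Proof.
by apply: ncs_ext => w; rewrite {1}/left_deriv nc_mul_cons ncs_addE ncs_scaleE.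
Qed.

(** By induction on the word: [left_deriv_mul] reduces associativity at
    [b :: w] to bilinearity and associativity at [w]. *)
Lemma nc_mulA : associative nc_mul.
Proof.
suff A w (f g h : ncs) : nc_mul f (nc_mul g h) w = nc_mul (nc_mul f g) h w.
  by move=> f g h; apply: ncs_ext => w; exact: A.
elim: w f g h => [|b w IH] f g h; first by rewrite !nc_mul_nil mulrA.
rewrite !nc_mul_cons left_deriv_mul nc_mulDl nc_mulZl ncs_addE ncs_scaleE.
by rewrite nc_mul_nil mulrDr IH !addrA mulrA.
Qed.

Lemma nc_mul1l : left_id nc_one nc_mul.
Proof.
move=> f; apply: ncs_ext => -[|b w]; rewrite ?nc_mul_nil ?nc_mul_cons mul1r //.
by rewrite /nc_mul big1 ?addr0 // => i _; rewrite mul0r.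
Qed.

Lemma nc_mul1r : right_id nc_one nc_mul.
Proof.
suff A w (f : ncs) : nc_mul f nc_one w = f w.
  by move=> f; apply: ncs_ext => w; exact: A.
elim: w f => [|b w IH] f; rewrite ?nc_mul_nil ?nc_mul_cons ?mulr1 //.
by rewrite mulr0 add0r IH.
Qed.

Lemma nc_one_neq0 : (nc_one : ncs) != 0.
Proof.
by apply/eqP => /(congr1 (fun f : ncs => f [::])) /eqP;
  rewrite /nc_one oner_eq0.
Qed.

HB.instance Definition _ := GRing.Zmodule_isNzRing.Build ncs
  nc_mulA nc_mul1l nc_mul1r nc_mulDl nc_mulDr nc_one_neq0.

HB.instance Definition _ := GRing.Lmodule_isLalgebra.Build rat ncs
  (fun a f g => esym (nc_mulZl a f g)).

HB.instance Definition _ := GRing.Lalgebra_isAlgebra.Build rat ncs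
  (fun a f g => esym (nc_mulZr a f g)).

Lemma nc_mulE (f g : ncs) : nc_mul f g = f * g.
Proof. by []. Qed.

Lemma nc_powE (f : ncs) k : nc_pow f k = f ^+ k.
Proof. by elim: k => [//|k IH]; rewrite exprS -IH. Qed.

Lemma ncs_sumE (I : Type) (r : seq I) (P : pred I) (F : I -> ncs) w :
  (\sum_(i <- r | P i) F i) w = \sum_(i <- r | P i) F i w.
Proof.
elim: r => [|i r IH]; first by rewrite !big_nil.
by rewrite !big_cons; case: ifP => // _; rewrite ncs_addE IH.
Qed.

Lemma ncsM_nil (f g : ncs) : (f * g) [::] = f [::] * g [::].
Proof. exact: nc_mul_nil. Qed.

(** The d-th power of the ideal of the series without constant term.  Infinite
    sums are avoided by working modulo these ideals. *)
Definition low (d : nat) (f : ncs) := forall w, (size w < d)%N -> f w = 0.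

Lemma low0 f : low 0 f. Proof. by []. Qed.

Lemma lowW a b f : (a <= b)%N -> low b f -> low a f.
Proof. by move=> ab bf w wa; apply: bf; exact: leq_trans wa ab. Qed.

Lemma low_add d f g : low d f -> low d g -> low d (f + g).
Proof. by move=> lf lg w wd; rewrite ncs_addE lf ?lg ?addr0. Qed.

Lemma low_opp d f : low d f -> low d (- f).
Proof. by move=> lf w wd; rewrite ncs_oppE lf ?oppr0. Qed.

Lemma low_scale d a f : low d f -> low d (a *: f).
Proof. by move=> lf w wd; rewrite ncs_scaleE lf ?mulr0. Qed.

Lemma low_zero d : low d 0. Proof. by []. Qed.

Lemma low_sum d (I : eqType) (r : seq I) (P : pred I) (F : I -> ncs) :
  (forall i, i \in r -> P i -> low d (F i)) -> low d (\sum_(i <- r | P i) F i).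
Proof.
move=> lF w wd; rewrite ncs_sumE big_seq_cond big1 // => i /andP[ir Pi].
exact: lF.
Qed.

Lemma low_mul a b f g : low a f -> low b g -> low (a + b) (f * g).
Proof.
move=> lf lg w wab; rewrite -nc_mulE /nc_mul big1 // => i _.
have iw : (i <= size w)%N by rewrite -ltnS.
have [ia|ai] := ltnP i a.
  by rewrite lf ?mul0r // size_takel.
rewrite [g _]lg ?mulr0 // size_drop ltn_subLR //.
by rewrite (leq_trans wab) // leq_add2r.
Qed.

Lemma low_exp a (f : ncs) k : low a f -> low (k * a) (f ^+ k).
Proof.
move=> lf; elim: k => [|k IH]; first exact: low0.
by rewrite exprS mulSn; apply: low_mul.
Qed.

Lemma low1P f : low 1 f <-> f [::] = 0.
Proof. by split=> [/(_ [::])->//|f0 [|//] _]. Qed.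

Definition eqlow N (f g : ncs) := low N.+1 (f - g).

(** * Exponential and logarithm are inverse to each other *)

(** Truncations suffice: substituting a series without constant term for the
    variable, the neglected terms have degree greater than N. *)
Definition exp_poly N : {poly rat} := \poly_(k < N.+1) (k`!%:R)^-1.

(** The coefficient of degree 0 is -1 / 0 = 0. *)
Definition log_poly N : {poly rat} := \poly_(k < N.+1) ((-1) ^+ k.+1 / k%:R).

Lemma natr_rat_neq0 k : (k.+1%:R : rat) != 0.
Proof. by rewrite pnatr_eq0. Qed.

Lemma dvdp_Xn_coef (p : {poly rat}) N i : 'X^N %| p -> (i < N)%N -> p`_i = 0.
Proof. by case/dvdpP=> q -> iN; rewrite coefMXn iN. Qed.

Lemma coef_dvdp_Xn (p : {poly rat}) N :
  (forall i, (i < N)%N -> p`_i = 0) -> 'X^N %| p.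
Proof.
move=> pN; rewrite -(poly_take_drop N p) dvdp_addl ?dvdp_mull //.
rewrite (_ : take_poly N p = 0) ?dvdp0 //; apply/polyP=> i.
by rewrite coef_take_poly coef0; case: ifP => // /pN.
Qed.

Lemma dvdp_X (p : {poly rat}) : p`_0 = 0 -> 'X %| p.
Proof. by move=> p0; rewrite -['X]expr1; apply: coef_dvdp_Xn => -[]. Qed.

Lemma log_poly0 N : (log_poly N)`_0 = 0.
Proof. by rewrite coef_poly /= invr0 mulr0. Qed.

Lemma exp_poly0 N : (exp_poly N)`_0 = 1.
Proof. by rewrite coef_poly /= invr1. Qed.

Lemma deriv_exp_poly N :
  (exp_poly N)^`() = exp_poly N - (N`!%:R)^-1 *: 'X^N.
Proof.
apply/polyP=> i; rewrite coef_deriv coefB coefZ coefXn !coef_poly ltnS.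
have [iN|Ni] := ltnP i N.
  rewrite ltnS (ltnW iN) (ltn_eqF iN) mulr0 subr0 -[_ *+ i.+1]mulr_natr factS
    natrM invfM.
  by rewrite mulrAC mulVf ?mul1r ?natr_rat_neq0.
rewrite mul0rn ltnS leq_eqVlt ltnNge Ni orbF.
by case: eqP => [->|_]; rewrite ?mulr1 ?subrr ?mulr0 ?subr0.
Qed.

Lemma deriv_log_poly N : 'X^N %| (1 + 'X) * (log_poly N)^`() - 1.
Proof.
have dL i : (i < N)%N -> ((log_poly N)^`())`_i = (-1) ^+ i.
  move=> iN; rewrite coef_deriv coef_poly ltnS iN -[_ *+ i.+1]mulr_natr.
  by rewrite mulfVK ?natr_rat_neq0 // !exprS mulN1r mulN1r opprK.
apply: coef_dvdp_Xn => -[|i] iN; rewrite coefB mulrDl mul1r coefD coefXM coef1.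
  by rewrite /= dL // addr0 subrr.
by rewrite /= !dL ?(ltnW iN) // exprS mulN1r addNr subr0.
Qed.

(** With p = exp (log (1 + t)), the derivatives of exp and log give
    (1 + t) p' = p modulo t ^ N, a recurrence on the coefficients of p whose
    solution with p(0) = 1 is 1 + t. *)
Lemma exp_log_poly N i : (i <= N)%N ->
  (exp_poly N \Po log_poly N)`_i = (1 + 'X)`_i.
Proof.
set L := log_poly N; set p := exp_poly N \Po L.
have p0 : p`_0 = 1.
  by rewrite -horner_coef0 horner_comp horner_coef0 log_poly0 horner_coef0
    exp_poly0.
have dp : 'X^N %| (1 + 'X) * p^`() - p.
  rewrite /p deriv_comp deriv_exp_poly comp_polyB comp_polyZ comp_Xn_poly
    mulrCA.
  have LN : 'X^N %| L ^+ N by rewrite dvdp_exp2r // dvdp_X ?log_poly0.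
  have -> (a b c : {poly rat}) : (a - b) * c - a = (a - b) * (c - 1) - b.
    by ring.
  rewrite dvdp_addl; first by rewrite dvdp_mull // deriv_log_poly.
  by rewrite dvdpNr -mul_polyC dvdp_mull.
have pS k : (k < N)%N -> p`_k.+1 *+ k.+1 = p`_k - p`_k *+ k.
  move=> kN; have /eqP := dvdp_Xn_coef dp kN.
  rewrite coefB mulrDl mul1r coefD coefXM !coef_deriv subr_eq0 => /eqP h.
  rewrite -[X in X - _]h {h}.
  by case: k {kN} => [|k]; rewrite /= ?mulr0n ?subr0 ?addr0 ?addrK.
have p1 : (0 < N)%N -> p`_1 = 1 by move=> /pS; rewrite p0 subr0 mulr1n.
have p2 k : (k.+2 <= N)%N -> p`_k.+2 = 0.
  elim: k => [|k IH] kN; apply/eqP.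
    by have := pS _ kN; rewrite mulr1n subrr => /eqP; rewrite mulrn_eq0.
  by have /eqP := pS _ kN; rewrite IH ?(ltnW kN) // mul0rn subr0 mulrn_eq0.
by rewrite coefD coef1 coefX; case: i => [|[|i]] iN /=;
  rewrite ?addr0 ?add0r ?p0 ?p1 ?p2.
Qed.

(** The derivative of log (1 + s) at s = exp t - 1 is 1 modulo t ^ N, because
    the factor 1 + s cancels the derivative of s. *)
Lemma log_exp_poly N i : (i <= N)%N ->
  (log_poly N \Po (exp_poly N - 1))`_i = 'X`_i.
Proof.
set s := exp_poly N - 1; set q := log_poly N \Po s.
have s0 : s`_0 = 0 by rewrite coefB coef1 exp_poly0 subrr.
have q0 : q`_0 = 0.
  by rewrite -horner_coef0 horner_comp horner_coef0 s0 horner_coef0 log_poly0.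
have dq : 'X^N %| q^`() - 1.
  have -> : q^`() - 1
      = ((1 + 'X) * (log_poly N)^`() - 1) \Po s
        - ((log_poly N)^`() \Po s) * ((N`!%:R)^-1 *: 'X^N).
    rewrite comp_polyB comp_polyM comp_polyD comp_polyX comp_polyC.
    rewrite /q deriv_comp derivB derivC subr0 deriv_exp_poly.
    rewrite polyC1; move: (_ \Po s) => t; rewrite /s; ring.
  rewrite dvdp_addl; last by rewrite dvdpNr dvdp_mull // -mul_polyC dvdp_mull.
  have /dvdpP[r ->] := deriv_log_poly N.
  by rewrite comp_polyM comp_Xn_poly dvdp_mull // dvdp_exp2r // dvdp_X.
case: i => [|i] iN; first by rewrite q0 coefX.
have /eqP := dvdp_Xn_coef dq iN.
rewrite coefB coef_deriv coef1 coefX subr_eq0; case: i {iN} => [|i] /=.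
  by rewrite mulr1n => /eqP.
by rewrite /= mulrn_eq0 /= => /eqP.
Qed.

Lemma horner_algE (f : ncs) (p : {poly rat}) N : (size p <= N)%N ->
  horner_alg f p = \sum_(k < N) p`_k *: f ^+ k.
Proof.
move=> pN; rewrite -{1}(coefK p) (poly_def (size p)).
rewrite (big_ord_widen _ (fun k => p`_k *: 'X^k) pN).
rewrite big_mkcond linear_sum; apply: eq_bigr => k _ /=.
case: ifPn => [_|].
  by rewrite linearZ /= mulr_algl rmorphXn /= horner_algX.
by rewrite -leqNgt linear0 => sk; rewrite nth_default // scale0r.
Qed.

Lemma horner_alg_comp (f : ncs) (p q : {poly rat}) :
  horner_alg f (p \Po q) = horner_alg (horner_alg f q) p.
Proof.
rewrite comp_polyE linear_sum (horner_algE _ (leqnn _)).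
by apply: eq_bigr => k _; rewrite linearZ /= mulr_algl rmorphXn.
Qed.

Lemma horner_alg_eqlow (f : ncs) (p q : {poly rat}) N : low 1 f ->
  (forall i, (i <= N)%N -> p`_i = q`_i) ->
  eqlow N (horner_alg f p) (horner_alg f q).
Proof.
move=> f1 pq; rewrite /eqlow -rmorphB /= (horner_algE _ (leqnn _)).
apply: low_sum => k _ _; rewrite coefB.
have [kN|Nk] := leqP k N; first by rewrite pq // subrr scale0r; apply: low_zero.
by apply: low_scale; apply: lowW (low_exp (k:=k) f1); rewrite muln1.
Qed.

Lemma nc_expE f w N : low 1 f -> (size w <= N)%N ->
  nc_exp f w = horner_alg f (exp_poly N) w.
Proof.
move=> f1 wN; rewrite (horner_algE _ (size_poly _ _)) ncs_sumE /nc_exp.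
rewrite (big_ord_widen _ (fun k => nc_pow f k w / k`!%:R) (wN : (_ < N.+1)%N)).
rewrite big_mkcond; apply: eq_bigr => k _; rewrite ncs_scaleE coef_poly ltn_ord.
case: ifPn => [_|]; first by rewrite nc_powE mulrC.
by rewrite -leqNgt => wk; rewrite (low_exp (k:=k) f1) ?mulr0 // muln1.
Qed.

Lemma nc_logE f w N : low 1 (f - 1) -> (size w <= N)%N ->
  nc_log f w = horner_alg (f - 1) (log_poly N) w.
Proof.
move=> f1 wN; rewrite (horner_algE _ (size_poly _ _)) ncs_sumE /nc_log.
rewrite big_ord_recl ncs_scaleE log_poly0 mul0r add0r big_add1 /= big_mkord.
rewrite (big_ord_widen _ (fun k => (-1) ^+ k.+2 / k.+1%:R
  * nc_pow (nc_sub f nc_one) k.+1 w) wN).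
rewrite big_mkcond; apply: eq_bigr => k _.
rewrite ncs_scaleE coef_poly /= /bump /= add1n ltnS ltn_ord.
case: ifPn => [_|]; first by rewrite nc_powE; congr (_ * _); rewrite exprS.
by rewrite -leqNgt => wk; rewrite (low_exp (k:=k.+1) f1) ?mulr0 // muln1 ltnS.
Qed.

Lemma nc_exp_low f : low 1 f -> low 1 ((nc_exp f : ncs) - 1).
Proof.
move=> f1; apply/low1P; rewrite ncs_addE ncs_oppE /nc_exp big_ord1.
by rewrite divr1 subrr.
Qed.

Lemma nc_log_low f : low 1 (nc_log f).
Proof. by apply/low1P; rewrite /nc_log big_geq. Qed.

Lemma eqlow_horner_alg f g (p : {poly rat}) N :
  eqlow N f g -> eqlow N (horner_alg f p) (horner_alg g p).
Proof.
move=> fg; rewrite /eqlow !(horner_algE _ (leqnn (size p))) -sumrB.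
apply: low_sum => k _ _; rewrite -scalerBr; apply: low_scale.
move: (k : nat) => {}k; elim: k => [|k IH].
  by rewrite subrr; apply: low_zero.
have -> : f ^+ k.+1 - g ^+ k.+1 = (f - g) * f ^+ k + g * (f ^+ k - g ^+ k).
  by rewrite mulrBl mulrBr -!exprS addrA subrK.
apply: low_add; first by rewrite -[N.+1]addn0; apply: low_mul.
by rewrite -[N.+1]add0n; apply: low_mul.
Qed.

Lemma nc_exp_eqlow f N : low 1 f ->
  eqlow N (nc_exp f) (horner_alg f (exp_poly N)).
Proof.
by move=> f1 w wN; rewrite ncs_addE ncs_oppE (@nc_expE _ _ N) ?subrr.
Qed.

Lemma nc_log_eqlow f N : low 1 (f - 1) ->
  eqlow N (nc_log f) (horner_alg (f - 1) (log_poly N)).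
Proof.
by move=> f1 w wN; rewrite ncs_addE ncs_oppE (@nc_logE _ _ N) ?subrr.
Qed.

Lemma eqlowE N f g w : eqlow N f g -> (size w <= N)%N -> f w = g w.
Proof. by move=> fg wN; apply/eqP; rewrite -subr_eq0; apply/eqP/fg. Qed.

Lemma eqlow_sym N f g : eqlow N f g -> eqlow N g f.
Proof. by move=> fg; rewrite /eqlow -opprB; apply: low_opp. Qed.

Lemma nc_exp_log f : low 1 (f - 1) -> nc_exp (nc_log f) = f.
Proof.
move=> f1; apply: ncs_ext => w; set N := size w.
rewrite (@nc_expE _ _ N) ?leqnn //; last exact: nc_log_low.
rewrite (eqlowE (eqlow_horner_alg (exp_poly N) (nc_log_eqlow (N:=N) f1))) //.
rewrite -horner_alg_comp.
rewrite (eqlowE (horner_alg_eqlow f1 (@exp_log_poly N))) //.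
by rewrite rmorphD rmorph1 /= horner_algX addrC subrK.
Qed.

Lemma nc_log_exp f : low 1 f -> nc_log (nc_exp f) = f.
Proof.
move=> f1; apply: ncs_ext => w; set N := size w.
rewrite (@nc_logE _ _ N) ?leqnn //; last exact: (nc_exp_low f1).
have e : eqlow N ((nc_exp f : ncs) - 1) (horner_alg f (exp_poly N - 1)).
  rewrite rmorphB rmorph1 /eqlow opprB addrA subrK; exact: nc_exp_eqlow.
rewrite (eqlowE (eqlow_horner_alg (log_poly N) e)) // -horner_alg_comp.
by rewrite (eqlowE (horner_alg_eqlow f1 (@log_exp_poly N))) // horner_algX.
Qed.

(** * The differential equation of the Baker-Campbell-Hausdorff series *)

Lemma eqlow_refl N f : eqlow N f f.
Proof. by rewrite /eqlow subrr; apply: low_zero. Qed.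

Lemma eqlow_trans N f g h : eqlow N f g -> eqlow N g h -> eqlow N f h.
Proof.
move=> fg gh; rewrite /eqlow (_ : f - h = (f - g) + (g - h)); last first.
  by rewrite addrA subrK.
exact: low_add.
Qed.

Lemma eqlow_add N f g f' g' :
  eqlow N f f' -> eqlow N g g' -> eqlow N (f + g) (f' + g').
Proof.
move=> ff gg; rewrite /eqlow opprD addrACA; exact: low_add.
Qed.

Lemma eqlow_mul N f g f' g' :
  eqlow N f f' -> eqlow N g g' -> eqlow N (f * g) (f' * g').
Proof.
move=> ff gg; rewrite /eqlow.
have -> : f * g - f' * g' = (f - f') * g + f' * (g - g').
  by rewrite mulrBl mulrBr addrA subrK.
apply: low_add; first by rewrite -[N.+1]addn0; apply: low_mul.
by rewrite -[N.+1]add0n; apply: low_mul.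
Qed.

Lemma eqlow_eq f g : (forall N, eqlow N f g) -> f = g.
Proof. by move=> fg; apply: ncs_ext => w; apply: (eqlowE (fg (size w))). Qed.

Definition euler (f : ncs) : ncs := fun w => (size w)%:R * f w.

Lemma euler_is_linear : linear euler.
Proof.
move=> a f g; apply: ncs_ext => w.
by rewrite /euler !(ncs_addE, ncs_scaleE) mulrDr mulrCA.
Qed.

HB.instance Definition _ :=
  GRing.isLinear.Build rat ncs ncs _ euler euler_is_linear.

(** The Euler operator is a derivation because lengths of words add up under
    concatenation. *)
Lemma eulerM f g : euler (f * g) = euler f * g + f * euler g.
Proof.
apply: ncs_ext => w; rewrite ncs_addE -!nc_mulE /euler /nc_mul mulr_sumr.
rewrite -big_split; apply: eq_bigr => i _ /=.
have iw : (i <= size w)%N by rewrite -ltnS.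
rewrite size_takel // size_drop natrB //; ring.
Qed.

Lemma euler1 : euler 1 = 0.
Proof. by apply: ncs_ext => -[|b w]; rewrite /euler ?mul0r ?mulr0. Qed.

Lemma euler_low d f : low d f -> low d (euler f).
Proof. by move=> lf w wd; rewrite /euler lf ?mulr0. Qed.

Lemma eqlow_euler N f g : eqlow N f g -> eqlow N (euler f) (euler g).
Proof. by move=> fg; rewrite /eqlow -linearB; apply: euler_low. Qed.

Lemma triangular_sum (V : nmodType) (G : nat -> nat -> V) M :
  \sum_(n < M) \sum_(k < n.+1) G (n - k)%N k
  = \sum_(k < M) \sum_(j < M - k) G j k.
Proof.
elim: M => [|M IH]; first by rewrite !big_ord0.
rewrite big_ord_recr /= IH [in RHS]big_ord_recr /= big_ord_recr /= addrA.
rewrite subnn subSnn big_ord1 -big_split /=; congr (_ + _).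
by apply: eq_bigr => k _; rewrite subSn ?(ltnW (ltn_ord k)) // big_ord_recr.
Qed.

Lemma eqlow_sum N (I : finType) (F G : I -> ncs) :
  (forall i, eqlow N (F i) (G i)) -> eqlow N (\sum_i F i) (\sum_i G i).
Proof.
by move=> FG; rewrite /eqlow -sumrB; apply: low_sum => i _ _; exact: FG.
Qed.

Lemma low_sum_widen d a b (F : nat -> ncs) : (a <= b)%N ->
  (forall i, (a <= i)%N -> low d (F i)) ->
  low d (\sum_(i < b) F i - \sum_(i < a) F i).
Proof.
move=> ab Fd.
have -> : \sum_(i < b) F i = \sum_(i < a) F i + \sum_(a <= i < b) F i.
  by rewrite -!(big_mkord xpredT) -big_cat_nat.
rewrite addrC addKr big_nat_cond; apply: low_sum => i _ /andP[/andP[ai _] _].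
exact: Fd.
Qed.

(** The terms with j + k + d > N of the product of the sums, which the right
    side omits, have degree greater than N. *)
Lemma cauchy_product (p q : nat -> ncs) d N : (d <= N.+1)%N ->
  (forall j, low j (p j)) -> (forall k, low (k + d) (q k)) ->
  eqlow N ((\sum_(j < N.+1) p j) * (\sum_(k < N.+1) q k))
    (\sum_(n < N.+1 - d) \sum_(k < n.+1) p (n - k)%N * q k).
Proof.
move=> dN lp lq; have lpq j k : (N < j + k + d)%N -> low N.+1 (p j * q k).
  by move=> jk; refine (lowW _ (low_mul (lp j) (lq k))); rewrite addnA.
rewrite (triangular_sum (fun j k => p j * q k)) mulr_sumr; set M := (_ - d)%N.
apply: eqlow_trans
  (_ : eqlow N _ (\sum_(k < N.+1) \sum_(j < M - k) p j * q k)) _.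
  apply: eqlow_sum => k; rewrite mulr_suml;
    apply: (@low_sum_widen _ (M - k) N.+1 (fun j => p j * q k)).
    by rewrite -subnDA leq_subr.
  move=> j; rewrite leq_subLR leq_subLR => jk.
  by apply: lpq; rewrite [(j + k)%N]addnC addnC.
apply: (@low_sum_widen _ M N.+1 (fun k => \sum_(j < M - k) p j * q k)).
  exact: leq_subr.
move=> k Mk; rewrite (eqP (Mk : M - k == 0)%N) big_ord0; exact: low_zero.
Qed.

Lemma fact_rat_neq0 k : (k`!%:R : rat) != 0.
Proof. by rewrite pnatr_eq0 -lt0n fact_gt0. Qed.

(** Divided powers: they absorb all the binomial coefficients below. *)
Definition dpow (z : ncs) k : ncs := (k`!%:R)^-1 *: z ^+ k.

Definition ad (z f : ncs) : ncs := z * f - f * z.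

Lemma ad_is_linear z : linear (ad z).
Proof.
move=> a f g; rewrite /ad mulrDr mulrDl scalerBr scalerAr scalerAl opprD.
by rewrite addrACA.
Qed.

HB.instance Definition _ z :=
  GRing.isLinear.Build rat ncs ncs _ (ad z) (ad_is_linear z).

(** The terms of exp (- z) f exp z as a power series in ad z. *)
Definition conj_term z f k : ncs := ((-1) ^+ k / k`!%:R) *: iter k (ad z) f.

(** For f = D z with D a derivation, the terms of exp (- z) D (exp z) as a
    power series in ad z. *)
Definition dexp_term z f k : ncs := ((-1) ^+ k / k.+1`!%:R) *: iter k (ad z) f.

Lemma dpowS z k : z * dpow z k = k.+1%:R *: dpow z k.+1.
Proof.
rewrite /dpow -scalerAr -exprS scalerA; congr (_ *: _).
by rewrite factS natrM invfM mulrA mulfV ?natr_rat_neq0 ?mul1r.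
Qed.

Lemma dpowSr z k : dpow z k * z = k.+1%:R *: dpow z k.+1.
Proof. by rewrite -dpowS /dpow -scalerAl -scalerAr -exprS exprSr. Qed.

Lemma conj_termS z f k :
  conj_term z f k * z = z * conj_term z f k + k.+1%:R *: conj_term z f k.+1.
Proof.
set a := conj_term z f k.
suff -> : k.+1%:R *: conj_term z f k.+1 = - ad z a.
  by rewrite /ad opprB addrC subrK.
rewrite /a /conj_term [in RHS]linearZ -scaleNr scalerA; congr (_ *: _).
by rewrite exprS factS natrM; field; rewrite fact_rat_neq0 nat1r natr_rat_neq0.
Qed.

Lemma dexp_termS z f k : k.+1%:R *: dexp_term z f k = conj_term z f k.
Proof.
rewrite /dexp_term /conj_term scalerA; congr (_ *: _).
by rewrite factS natrM; field; rewrite fact_rat_neq0 nat1r natr_rat_neq0.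
Qed.

(** By induction on n, moving z to the left through f at the cost of a
    bracket.  The factor n + 1 by which divided powers of orders n and n + 1
    differ splits as (n + 1 - k) + k, one summand for each of the two terms
    that are produced. *)
Lemma mul_dpow z f n :
  f * dpow z n = \sum_(k < n.+1) dpow z (n - k) * conj_term z f k.
Proof.
elim: n => [|n IH].
  by rewrite big_ord1 /dpow /conj_term !expr0 divr1 invr1 !scale1r mulr1 mul1r.
apply: (scalerI (natr_rat_neq0 n)).
rewrite scalerAr -dpowSr mulrA IH mulr_suml scaler_sumr.
transitivity (\sum_(k < n.+1)
   ((n - k).+1%:R *: (dpow z (n - k).+1 * conj_term z f k)
   + k.+1%:R *: (dpow z (n - k) * conj_term z f k.+1))).
  apply: eq_bigr => k _.
  by rewrite -mulrA conj_termS mulrDr -(scalerAr k.+1%:R) mulrA dpowSr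
    -(scalerAl (n - k).+1%:R).
rewrite big_split /=.
have -> : \sum_(k < n.+2) n.+1%:R *: (dpow z (n.+1 - k) * conj_term z f k)
  = \sum_(k < n.+2) (n.+1 - k)%:R *: (dpow z (n.+1 - k) * conj_term z f k)
  + \sum_(k < n.+2) k%:R *: (dpow z (n.+1 - k) * conj_term z f k).
  rewrite -big_split; apply: eq_bigr => k _ /=;
    rewrite -scalerDl -natrD subnK //.
  by rewrite -ltnS.
congr (_ + _).
  rewrite [in RHS]big_ord_recr /= subnn mulr0n scale0r addr0;
    apply: eq_bigr => k _.
  by rewrite subSn // -ltnS.
by rewrite [in RHS]big_ord_recl mulr0n scale0r add0r; apply: eq_bigr.
Qed.

(** Same pattern as [mul_dpow], from
    E (z * z ^ n) = E z * z ^ n + z * E (z ^ n). *)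
Lemma euler_dpow z n :
  euler (dpow z n.+1)
  = \sum_(k < n.+1) dpow z (n - k) * dexp_term z (euler z) k.
Proof.
elim: n => [|n IH].
  rewrite big_ord1 /dpow /dexp_term !expr0 subnn !divr1 !invr1 !scale1r mul1r.
  by rewrite expr1.
apply: (scalerI (natr_rat_neq0 n.+1)).
have -> : n.+2%:R *: euler (dpow z n.+2) = euler (z * dpow z n.+1).
  by rewrite dpowS [RHS]linearZ.
rewrite eulerM mul_dpow IH mulr_sumr scaler_sumr.
have -> : \sum_(k < n.+2)
    n.+2%:R *: (dpow z (n.+1 - k) * dexp_term z (euler z) k)
  = \sum_(k < n.+2) k.+1%:R *: (dpow z (n.+1 - k) * dexp_term z (euler z) k)
  + \sum_(k < n.+2)
      (n.+1 - k)%:R *: (dpow z (n.+1 - k) * dexp_term z (euler z) k).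
  rewrite -big_split; apply: eq_bigr => k _ /=; rewrite -scalerDl -natrD addSn.
  by rewrite subnKC // -ltnS.
congr (_ + _).
  by apply: eq_bigr => k _; rewrite scalerAr dexp_termS.
rewrite [in RHS]big_ord_recr /= subnn mulr0n scale0r addr0;
  apply: eq_bigr => k _.
by rewrite mulrA dpowS -(scalerAl (n - k).+1%:R) subSn // -ltnS.
Qed.

Lemma dpow_low z k : low 1 z -> low k (dpow z k).
Proof.
move=> lz; apply: low_scale; rewrite -[X in low X _]muln1; exact: low_exp.
Qed.

Lemma iter_ad_low z f k d : low 1 z -> low d f -> low (k + d) (iter k (ad z) f).
Proof.
move=> lz lf; elim: k => [//|k IH]; rewrite iterS.
apply: low_add; first by rewrite addSn -add1n; apply: low_mul.
by apply: low_opp; rewrite addSn -addn1; apply: low_mul.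
Qed.

Lemma nc_exp_dpow z N : low 1 z ->
  eqlow N (nc_exp z) (\sum_(k < N.+1) dpow z k).
Proof.
move=> lz; have := nc_exp_eqlow (N:=N) lz.
rewrite (horner_algE _ (size_poly _ _)).
by under eq_bigr do rewrite coef_poly ltn_ord.
Qed.

(** f exp z = exp z (exp (- ad z) f). *)
Lemma mul_nc_exp z f N : low 1 z ->
  eqlow N (f * (nc_exp z : ncs))
    ((nc_exp z : ncs) * \sum_(k < N.+1) conj_term z f k).
Proof.
move=> lz; have ez := nc_exp_dpow (N:=N) lz.
apply: eqlow_trans (eqlow_mul (@eqlow_refl N f) ez) _.
apply: eqlow_sym; apply: eqlow_trans (eqlow_mul ez (@eqlow_refl N _)) _.
rewrite [X in eqlow _ _ X]mulr_sumr.
under [X in eqlow _ _ X]eq_bigr do rewrite mul_dpow.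
have := @cauchy_product (dpow z) (conj_term z f) 0 N.
rewrite subn0; apply=> // k.
  exact: dpow_low.
by apply: low_scale; apply: iter_ad_low.
Qed.

(** The differential of the exponential: the left logarithmic derivative of
    exp z is (1 - exp (- ad z)) / ad z applied to E z. *)
Lemma euler_nc_exp z N : low 1 z ->
  eqlow N (euler (nc_exp z))
    ((nc_exp z : ncs) * \sum_(k < N.+1) dexp_term z (euler z) k).
Proof.
move=> lz; have ez := nc_exp_dpow (N:=N) lz.
apply: eqlow_trans (eqlow_euler ez) _.
apply: eqlow_sym; apply: eqlow_trans (eqlow_mul ez (@eqlow_refl N _)) _.
rewrite linear_sum [X in eqlow _ _ X]big_ord_recl /=.
have -> : euler (dpow z 0) = 0.
  by rewrite /dpow expr0 [LHS]linearZ /= euler1 scaler0.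
rewrite add0r.
under [X in eqlow _ _ X]eq_bigr do rewrite /= /bump add1n euler_dpow.
have := @cauchy_product (dpow z) (dexp_term z (euler z)) 1 N.
rewrite subSS subn0; apply=> // k.
  exact: dpow_low.
by apply: low_scale; apply: iter_ad_low => //; apply: euler_low.
Qed.

(** A series with constant term 1 can be cancelled, by induction on the degree
    up to which f is known to vanish. *)
Lemma low_cancel d e f : low 1 (e - 1) -> low d (e * f) -> low d f.
Proof.
move=> le lef; suff : forall j, (j <= d)%N -> low j f by apply.
elim=> [//|j IH] jd.
have -> : f = e * f - (e - 1) * f by rewrite mulrBl mul1r opprB addrC subrK.
apply: low_add; first exact: lowW lef.
by apply: low_opp; rewrite -add1n; apply: low_mul => //; apply: IH; apply: ltnW.
Qed.

Notation ncX := (nc_var false : ncs).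
Notation ncY := (nc_var true : ncs).

Lemma euler_var b : euler (nc_var b) = (nc_var b : ncs).
Proof.
apply: ncs_ext => w; rewrite /euler /nc_var.
by case: eqP => [->|_]; rewrite ?mulr1 ?mulr0.
Qed.

Lemma low_var b : low 1 (nc_var b).
Proof. by apply/low1P. Qed.

Lemma ad_self f : ad f f = 0. Proof. exact: subrr. Qed.

(** All brackets vanish in [euler_nc_exp], since E z = z for a letter z. *)
Lemma euler_exp_var b :
  euler (nc_exp (nc_var b)) = (nc_exp (nc_var b) : ncs) * nc_var b.
Proof.
apply: eqlow_eq => N; apply: eqlow_trans (euler_nc_exp (N:=N) (@low_var b)) _.
rewrite big_ord_recl big1 => [|k _].
  by rewrite addr0 /dexp_term /= divr1 scale1r euler_var; apply: eqlow_refl.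
by rewrite /dexp_term /= -iterS iterSr euler_var ad_self iter_fix ?linear0
  ?scaler0.
Qed.

Lemma exp_var_comm b :
  (nc_var b : ncs) * nc_exp (nc_var b) = (nc_exp (nc_var b) : ncs) * nc_var b.
Proof.
apply: eqlow_eq => N; apply: eqlow_trans (mul_nc_exp _ (N:=N) (@low_var b)) _.
rewrite big_ord_recl big1 => [|k _].
  by rewrite addr0 /conj_term /= divr1 scale1r; apply: eqlow_refl.
by rewrite /conj_term /= -iterS iterSr ad_self iter_fix ?linear0 ?scaler0.
Qed.

Definition bch : ncs := bch_series.

Lemma low_mul1 f g : low 1 (f - 1) -> low 1 (g - 1) -> low 1 (f * g - 1).
Proof.
move=> lf lg; have -> : f * g - 1 = (f - 1) * g + (g - 1).
  by rewrite mulrBl mul1r addrA subrK.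
by apply: low_add => //; rewrite -[1%N]addn0; apply: low_mul.
Qed.

Lemma bch_low : low 1 bch.
Proof. exact: nc_log_low. Qed.

Lemma nc_exp_bch : nc_exp bch = (nc_exp ncX : ncs) * nc_exp ncY.
Proof.
by apply: nc_exp_log; apply: low_mul1; apply: nc_exp_low; apply: low_var.
Qed.

(** Apply the Euler derivation to exp Z = exp X exp Y, then cancel exp Z on
    the left. *)
Lemma bch_equation N :
  eqlow N (\sum_(k < N.+1) dexp_term bch (euler bch) k)
    (\sum_(k < N.+1) conj_term bch ncX k + ncY).
Proof.
have e1 := nc_exp_low bch_low; apply: (low_cancel e1); rewrite mulrBr mulrDr.
apply: eqlow_trans (eqlow_sym (euler_nc_exp (N:=N) bch_low)) _.
apply: eqlow_trans
  (_ : eqlow N _ (ncX * nc_exp bch + (nc_exp bch : ncs) * ncY)) _.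
  rewrite nc_exp_bch eulerM !euler_exp_var -exp_var_comm !mulrA;
    exact: eqlow_refl.
by apply: eqlow_add; [exact: mul_nc_exp bch_low|exact: eqlow_refl].
Qed.

(** * The homogeneous parts of the series are Lie polynomials *)

Definition homog_part (m : nat) (f : ncs) : ncs := fun w => if size w == m then
  f w else 0.

Lemma homog_part_is_linear m : linear (homog_part m).
Proof.
move=> a f g; apply: ncs_ext => w.
by rewrite /homog_part !(ncs_addE, ncs_scaleE); case: ifP;
  rewrite ?mulr0 ?addr0.
Qed.

HB.instance Definition _ m :=
  GRing.isLinear.Build rat ncs ncs _ (homog_part m) (homog_part_is_linear m).

Lemma homog_partM m (f g : ncs) :
  homog_part m (f * g) = \sum_(i < m.+1) homog_part i f * homog_part (m - i)%N
    g.
Proof.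
apply: ncs_ext => w; rewrite ncs_sumE.
transitivity (\sum_(i < m.+1) \sum_(j < (size w).+1)
    if (j == i :> nat) && (size w - j == m - i)%N
    then f (take j w) * g (drop j w) else 0); last first.
  apply: eq_bigr => i _; apply: eq_bigr => j _.
  rewrite /homog_part size_takel -1?ltnS // size_drop.
  by do 2 case: eqP => _; rewrite ?mul0r ?mulr0.
rewrite exchange_big /= /homog_part; case: eqP => [<-|wm].
  apply: eq_bigr => j _; rewrite (bigD1 j) //= !eqxx big1 ?addr0 // => i.
  by rewrite eq_sym -val_eqE /= => /negbTE->.
rewrite big1 // => j _; rewrite big1 // => i _.
case: ifP => // /andP[/eqP ji /eqP]; rewrite ji => e.
have iw : (i <= size w)%N by rewrite -ji -ltnS.
by case: wm; rewrite -(subnKC iw) e subnKC // -ltnS.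
Qed.

Lemma homog_part_ad m z f :
  homog_part m (ad z f) = \sum_(i < m.+1) ad (homog_part i z)
    (homog_part (m - i)%N f).
Proof.
rewrite /ad linearB /= !homog_partM sumrB; congr (_ - _).
rewrite (reindex_inj rev_ord_inj); apply: eq_bigr => i _ /=.
by rewrite subSS subKn // -ltnS.
Qed.

Lemma homog_part_low0 f : low 1 f -> homog_part 0 f = 0.
Proof. by move=> lf; apply: ncs_ext => -[|b w] //; apply: lf. Qed.

Definition lie_eval c : ncs := commutator_eval nc_bracket ncX ncY c.

Definition lie_comb (s : seq (rat * commutator)) : ncs :=
  \sum_(t <- s) t.1 *: lie_eval t.2.

Definition lie_hom m (f : ncs) := exists2 s : seq (rat * commutator),
  all (fun t => commutator_length t.2 == m) s & f = lie_comb s.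

Lemma lie_hom0 m : lie_hom m 0.
Proof. by exists [::]; rewrite // /lie_comb big_nil. Qed.

Lemma lie_homD m f g : lie_hom m f -> lie_hom m g -> lie_hom m (f + g).
Proof.
move=> [s ms ->] [t mt ->]; exists (s ++ t); first by rewrite all_cat ms.
by rewrite /lie_comb big_cat.
Qed.

Lemma lie_homZ m a f : lie_hom m f -> lie_hom m (a *: f).
Proof.
move=> [s ms ->]; exists [seq (a * t.1, t.2) | t <- s];
  first by rewrite all_map.
rewrite /lie_comb big_map scaler_sumr.
by apply: eq_bigr => t _; rewrite scalerA.
Qed.

Lemma lie_hom_sum m (I : Type) (r : seq I) (F : I -> ncs) :
  (forall i, lie_hom m (F i)) -> lie_hom m (\sum_(i <- r) F i).
Proof.
by move=> mF; elim/big_ind: _ => //; [exact: lie_hom0|exact: lie_homD].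
Qed.

Lemma lie_hom_eval c : lie_hom (commutator_length c) (lie_eval c).
Proof.
by exists [:: (1, c)]; rewrite /= ?eqxx // /lie_comb big_seq1 scale1r.
Qed.

Lemma lie_hom_ind m (P : ncs -> Prop) :
    P 0 -> (forall f g, P f -> P g -> P (f + g)) ->
    (forall a f, P f -> P (a *: f)) ->
    (forall c, commutator_length c = m -> P (lie_eval c)) ->
  forall f, lie_hom m f -> P f.
Proof.
move=> P0 PD PZ Pc f [s ms ->]; elim: s ms => [_|t s IH /= /andP[/eqP tm ms]].
  by rewrite /lie_comb big_nil.
by rewrite /lie_comb big_cons; apply: PD (IH ms); apply/PZ/Pc.
Qed.

Lemma lie_hom_ad i j f g :
  lie_hom i f -> lie_hom j g -> lie_hom (i + j) (ad f g).
Proof.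
move=> fi gj; elim/(@lie_hom_ind j): g / gj => [|g h IHg IHh|a g IHg|d dj].
- by rewrite linear0; apply: lie_hom0.
- by rewrite linearD; apply: lie_homD.
- by rewrite linearZ; apply: lie_homZ.
elim/(@lie_hom_ind i): f / fi => [|g h IHg IHh|a g IHg|c ci].
- by rewrite /ad mul0r mulr0 subrr; apply: lie_hom0.
- by rewrite /ad mulrDl mulrDr opprD addrACA; apply: lie_homD.
- by rewrite /ad -scalerAl -scalerAr -scalerBr; apply: lie_homZ.
by rewrite -ci -dj; apply: (lie_hom_eval (CBracket c d)).
Qed.

Definition lie_below m f := forall i, (i < m)%N -> lie_hom i (homog_part i f).

(** The gain of one degree is what makes the induction of [lie_hom_bch] work:
    without constant terms, the part of degree m of a bracket only involves
    parts of degrees less than m. *)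
Lemma lie_below_ad m z f : low 1 z -> low 1 f ->
  lie_below m z -> lie_below m f -> lie_below m.+1 (ad z f).
Proof.
move=> lz lf mz mf i im; rewrite homog_part_ad; apply: lie_hom_sum => j.
have [-> |j0] := posnP j.
  by rewrite homog_part_low0 // /ad mul0r mulr0 subrr; apply: lie_hom0.
have [ji|] := ltnP j i; last first.
  by rewrite -subn_eq0 => /eqP ->; rewrite homog_part_low0 // linear0;
    apply: lie_hom0.
rewrite -{1}(subnKC (ltnW ji)); apply: lie_hom_ad.
  by apply: mz; apply: leq_trans ji _.
apply: mf; apply: (@leq_trans i) => //.
by rewrite ltn_subrL j0 (leq_ltn_trans _ ji).
Qed.

Lemma lie_below_iter m z f k : low 1 z -> low 1 f ->
  lie_below m z -> lie_below m f -> lie_below m.+1 (iter k.+1 (ad z) f).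
Proof.
move=> lz lf mz mf; elim: k => [|k IH]; first exact: lie_below_ad.
rewrite iterS; apply: lie_below_ad => //.
  by apply: lowW (iter_ad_low (k:=k.+1) lz lf); rewrite addn1.
by move=> i im; apply: IH; apply: ltnW.
Qed.

Lemma homog_part_var b i :
  homog_part i (nc_var b) = if i == 1%N then (nc_var b : ncs) else 0.
Proof.
apply: ncs_ext => w; rewrite /homog_part /nc_var;
  case: (eqVneq w [:: b]) => [->|wb].
  by rewrite /= eq_sym; case: eqP => //; rewrite eqxx.
by case: (i == 1%N); rewrite ?(negbTE wb) if_same.
Qed.

Lemma lie_hom_var b i : lie_hom i (homog_part i (nc_var b)).
Proof.
rewrite homog_part_var; case: eqP => [->|_]; last exact: lie_hom0.
by case: b; [exact: (lie_hom_eval CY)|exact: (lie_hom_eval CX)].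
Qed.

Lemma homog_part_euler m f : homog_part m (euler f) = m%:R *: homog_part m f.
Proof.
apply: ncs_ext => w; rewrite ncs_scaleE /homog_part /euler.
by case: eqP => [->|_]; rewrite ?mulr0.
Qed.

(** In degree m, the term k = 0 of the left side of [bch_equation] is m Z_m,
    and all the other terms only involve the parts of Z of degrees less than
    m. *)
Lemma lie_hom_bch m : lie_hom m (homog_part m bch).
Proof.
elim/ltn_ind: m => m IH; have lb := bch_low.
have [-> |m0] := posnP m; first by rewrite homog_part_low0 //; apply: lie_hom0.
have mb : lie_below m bch by [].
have le : low 1 (euler bch) by apply: euler_low.
have me : lie_below m (euler bch).
  by move=> i im; rewrite homog_part_euler; apply: lie_homZ; apply: IH.
suff mm : lie_hom m (m%:R *: homog_part m bch).
  have m0' : (m%:R : rat) != 0 by rewrite pnatr_eq0 -lt0n.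
  by rewrite -[homog_part m _]scale1r -(mulVf m0') -scalerA; apply: lie_homZ.
have eqm : homog_part m (\sum_(k < m.+1) dexp_term bch (euler bch) k)
    = homog_part m (\sum_(k < m.+1) conj_term bch ncX k + ncY).
  apply: ncs_ext => w; rewrite /homog_part; case: eqP => // wm.
  by apply: (eqlowE (@bch_equation m)); rewrite wm.
have lie_iter (f : ncs) c k : low 1 f -> lie_below m f ->
    lie_hom m (homog_part m (c *: iter k.+1 (ad bch) f)).
  move=> lf mf; rewrite linearZ; apply: lie_homZ.
  exact: (lie_below_iter (m:=m)).
rewrite -homog_part_euler.
have -> : homog_part m (euler bch)
    = homog_part m (\sum_(k < m.+1) conj_term bch ncX k + ncY)
    - \sum_(k < m) homog_part m (dexp_term bch (euler bch) k.+1).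
  rewrite -eqm big_ord_recl linearD linear_sum /= addrK /dexp_term /=.
  by rewrite divr1 scale1r.
apply: lie_homD; last first.
  by rewrite -scaleN1r; apply: lie_homZ; apply: lie_hom_sum => k;
    apply: lie_iter.
rewrite linearD /=; apply: lie_homD; last exact: lie_hom_var.
rewrite linear_sum; apply: lie_hom_sum => -[[|k] _] /=.
  by rewrite /conj_term /= divr1 scale1r; apply: lie_hom_var.
by apply: lie_iter; [exact: low_var|move=> i _; exact: lie_hom_var].
Qed.

(** * The terms of degree at most four *)

(** Iterated operators do not compute, being locked; the functions below are
    versions of the formal operations that do. *)
Definition sum_list (s : seq nat) (F : nat -> rat) :=
  foldr (fun i => +%R (F i)) 0 s.

Lemma sum_listE s F : \sum_(i <- s) F i = sum_list s F.
Proof. by elim: s => [|i s IH]; rewrite ?big_nil // big_cons IH. Qed.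

Definition mul_list (f g : ncseries) : ncseries := fun w =>
  sum_list (iota 0 (size w).+1) (fun i => f (take i w) * g (drop i w)).

Lemma mul_listE : nc_mul = mul_list.
Proof.
apply/funext => f; apply/funext => g; apply/funext => w.
rewrite /nc_mul -(big_mkord xpredT (fun i => f (take i w) * g (drop i w))).
by rewrite sum_listE /index_iota subn0.
Qed.

Definition pow_list (f : ncseries) k : ncseries := iter k (mul_list f) nc_one.

Lemma pow_listE : nc_pow = pow_list.
Proof. by rewrite /nc_pow mul_listE. Qed.

Definition exp_list (f : ncseries) : ncseries := fun w =>
  sum_list (iota 0 (size w).+1) (fun k => pow_list f k w / k`!%:R).

Lemma exp_listE : nc_exp = exp_list.
Proof.
apply/funext => f; apply/funext => w; rewrite /nc_exp pow_listE.
rewrite -(big_mkord xpredT (fun k => pow_list f k w / k`!%:R)).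
by rewrite sum_listE /index_iota subn0.
Qed.

Definition log_list (f : ncseries) : ncseries := fun w =>
  sum_list (iota 1 (size w)) (fun k =>
    (-1) ^+ k.+1 / k%:R * pow_list (nc_sub f nc_one) k w).

Lemma log_listE : nc_log = log_list.
Proof.
apply/funext => f; apply/funext => w.
by rewrite /nc_log pow_listE sum_listE /index_iota subn1.
Qed.

Definition low_terms (m : nat) : seq (rat * commutator) :=
  let XY := CBracket CX CY in
  match m with
  | 1 => [:: (1, CX); (1, CY)]
  | 2 => [:: (2^-1, XY)]
  | 3 => [:: (12^-1, CBracket CX XY); (12^-1, CBracket CY (CBracket CY CX))]
  | 4 => [:: (- 24^-1, CBracket CY (CBracket CX XY))]
  | _ => [::]
  end.

Definition bracket_list (f g : ncseries) : ncseries :=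
  nc_sub (mul_list f g) (mul_list g f).

(** Both sides are computed at each of the 31 words of length at most 4. *)
Lemma bch_low_terms w : (size w <= 4)%N ->
  bch_series w = \sum_(t <- low_terms (size w)) t.1 *
    commutator_eval nc_bracket (nc_var false) (nc_var true) t.2 w.
Proof.
move=> w4; have -> : nc_bracket = bracket_list.
  by rewrite /nc_bracket mul_listE.
rewrite /bch_series log_listE mul_listE exp_listE.
rewrite unlock; apply/eqP; move: w w4.
by case=> [|b1 [|b2 [|b3 [|b4 [|]]]]] // _;
  do ?[match goal with b : bool |- _ => case: b end]; vm_compute.
Qed.

(** * Evaluation at matrices whose long products vanish *)

(** Degrees up to 4 come from [low_terms], the others from [lie_hom_bch]. *)
Lemma bch_expression_exists : exists B,
  [/\ bch_expression B, bch_first_terms B & B 0%N = [::]].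
Proof.
have [s sm sE] : exists2 s : nat -> seq (rat * commutator),
    forall m, all (fun t => commutator_length t.2 == m) (s m)
    & forall m, homog_part m bch = lie_comb (s m).
  (* Choose the expressions in all degrees simultaneously. *)
  have h m : {s | all (fun t => commutator_length t.2 == m) s
                & homog_part m bch = lie_comb s}.
    exact: cid2 (lie_hom_bch m).
  by exists (fun m => s2val (h m)) => m; case: (h m).
exists (fun m => if (m <= 4)%N then low_terms m else s m); split => //; split.
  by move=> [|[|[|[|[|m]]]]] //=.
move=> w; case: leqP => [w4|_]; first exact: bch_low_terms.
have := congr1 (fun f : ncs => f w) (sE (size w)).
by rewrite /homog_part eqxx /lie_comb ncs_sumE.
Qed.

Lemma lie_eval_hom c w : size w != commutator_length c -> lie_eval c w = 0.
Proof.
elim: c w => [||c IHc d IHd] w /=.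
- by rewrite /lie_eval /= /nc_var; case: (eqVneq w) => // ->.
- by rewrite /lie_eval /= /nc_var; case: (eqVneq w) => // ->.
move=> wcd; rewrite /lie_eval /= /nc_bracket /nc_sub /nc_mul.
rewrite !big1 ?subrr // => i _; have iw : (i <= size w)%N by rewrite -ltnS.
  have [id|/IHd dw] := eqVneq (size (take i w)) (commutator_length d);
    last first.
    by rewrite [X in X * _]dw mul0r.
  rewrite [X in _ * X]IHc ?mulr0 // size_drop; apply: contraNneq wcd => <-.
  by rewrite -id size_takel // subnK.
have [ic|/IHc cw] := eqVneq (size (take i w)) (commutator_length c); last first.
  by rewrite [X in X * _]cw mul0r.
rewrite [X in _ * X]IHd ?mulr0 // size_drop; apply: contraNneq wcd => <-.
by rewrite -ic size_takel // subnKC.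
Qed.

Lemma lie_comb_hom m s w : all (fun t => commutator_length t.2 == m) s ->
  size w != m -> lie_comb s w = 0.
Proof.
move=> sm wm; rewrite /lie_comb ncs_sumE.
elim: s sm => [|t s IH] /=; rewrite ?big_nil // => /andP[/eqP tm sm].
by rewrite big_cons IH // ncs_scaleE lie_eval_hom ?mulr0 ?addr0 ?tm.
Qed.

Lemma bch_eq_sum B N : bch_expression B ->
  eqlow N bch (\sum_(m < N.+1) lie_comb (B m)).
Proof.
move=> [Bm BE] w wN; rewrite ncs_addE ncs_oppE ncs_sumE.
rewrite (bigD1 (Ordinal wN)) //= big1 => [|m].
  rewrite addr0 /bch BE /lie_comb ncs_sumE; apply/eqP; rewrite subr_eq0.
  by apply/eqP/eq_bigr => t _; rewrite ncs_scaleE.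
by rewrite -val_eqE /= eq_sym => wm; apply: lie_comb_hom (Bm m) wm.
Qed.

Section Evaluation.
Variables (L : numFieldType) (n : nat) (X Y : 'M[L]_n).

Definition letter_mx (b : bool) : 'M[L]_n := if b then Y else X.

Definition word_mx (w : seq bool) : 'M[L]_n := \prod_(b <- w) letter_mx b.

(** The sum of f w times the product of the letters of w, over the words w of
    length at most N, arranged by first letters as in Horner's scheme. *)
Fixpoint ev N (f : ncs) : 'M[L]_n :=
  (ratr (f [::]))%:M +
  if N is N'.+1 then \sum_b letter_mx b * ev N' (left_deriv b f) else 0.

Lemma mxscaleAr a (A B : 'M[L]_n) : a *: (A * B) = A * (a *: B).
Proof. exact: scalemxAr. Qed.

Lemma scalar_mxmul a (A : 'M[L]_n) : a%:M * A = a *: A.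
Proof. exact: mul_scalar_mx. Qed.

Lemma scalar_ratrM (a b : rat) :
  (ratr (a * b))%:M = ratr a *: (ratr b)%:M :> 'M[L]_n.
Proof. by rewrite scale_scalar_mx; congr _%:M; apply: rmorphM. Qed.

Lemma ev_is_additive N : {morph ev N : f g / f + g}.
Proof.
elim: N => [|N IH] f g /=.
  by rewrite ncs_addE rmorphD raddfD /= !addr0.
rewrite ncs_addE rmorphD raddfD /= [in RHS]addrACA; congr (_ + _).
by rewrite -big_split; apply: eq_bigr => b _ /=; rewrite -mulrDr -IH.
Qed.

Lemma evZ N a f : ev N (a *: f) = ratr a *: ev N f.
Proof.
elim: N f => [|N IH] f /=; rewrite ncs_scaleE scalar_ratrM.
  by rewrite !addr0.
rewrite scalerDr scaler_sumr; congr (_ + _).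
by apply: eq_bigr => b _; rewrite mxscaleAr -IH.
Qed.

Lemma ev0 N : ev N 0 = 0.
Proof. by rewrite -[0](scale0r 0) evZ rmorph0 scale0r. Qed.

Lemma evB N f g : ev N (f - g) = ev N f - ev N g.
Proof.
by rewrite ev_is_additive -scaleN1r evZ rmorphN rmorph1 scaleN1r.
Qed.

Lemma ev_sum N (I : Type) (r : seq I) (F : I -> ncs) :
  ev N (\sum_(i <- r) F i) = \sum_(i <- r) ev N (F i).
Proof. by rewrite (big_morph _ (@ev_is_additive N) (ev0 N)). Qed.

Lemma ev_low N f : low N.+1 f -> ev N f = 0.
Proof.
elim: N f => [|N IH] f lf /=; rewrite lf // rmorph0 raddf0 add0r //.
by rewrite big1 // => b _; rewrite IH ?mulr0 // => w wN; apply: lf.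
Qed.

Lemma ev_eqlow N f g : eqlow N f g -> ev N f = ev N g.
Proof. by move=> /ev_low /eqP; rewrite evB subr_eq0 => /eqP. Qed.

Lemma ev1 N : ev N 1 = 1.
Proof.
case: N => [|N] /=; rewrite rmorph1 ?addr0 // big1 ?addr0 // => b _.
by rewrite (_ : left_deriv b 1 = 0) ?ev0 ?mulr0.
Qed.

Lemma ev_var N b : ev N.+1 (nc_var b) = letter_mx b.
Proof.
rewrite /= rmorph0 raddf0 add0r (bigD1 b) //= big1 => [|c cb].
  rewrite addr0 (_ : left_deriv b (nc_var b) = 1) ?ev1 ?mulr1 //.
  by apply: ncs_ext => w; rewrite /left_deriv /nc_var eqseq_cons eqxx.
rewrite (_ : left_deriv c (nc_var b) = 0) ?ev0 ?mulr0 //.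
by apply: ncs_ext => w; rewrite /left_deriv /nc_var eqseq_cons (negbTE cb).
Qed.

Definition kills (W : 'M[L]_n) k :=
  forall w, (k <= size w)%N -> W * word_mx w = 0.

Lemma kills_letter W k b : kills W k.+1 -> kills (W * letter_mx b) k.
Proof.
by move=> Wk w kw; rewrite -mulrA -(Wk (b :: w) kw) /word_mx big_cons.
Qed.

Lemma kills1 W b : kills W 1 -> W * letter_mx b = 0.
Proof. by move/(_ [:: b] isT); rewrite /word_mx big_seq1. Qed.

Lemma ev_stable W k N f : kills W k.+1 -> (k <= N)%N -> W * ev N f = W * ev k f.
Proof.
elim: k N W f => [|k IH] [|N] W f Wk //= kN; rewrite !mulrDr; congr (_ + _).
  rewrite mulr0 mulr_sumr big1 // => b _.
  by rewrite mulrA kills1 ?mul0r.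
rewrite !mulr_sumr; apply: eq_bigr => b _; rewrite !mulrA.
by apply: IH => //; apply: kills_letter.
Qed.

(** Multiplicativity needs long products to vanish, and the recursion
    multiplies by letters on the left only; hence the left factor W, which
    records the letters already met.  The right factor keeps the full
    truncation N, as the letters of f come between W and g. *)
Lemma ev_mul_kills W k N f g : kills W k.+1 -> (k <= N)%N ->
  W * ev k (f * g) = W * ev k f * ev N g.
Proof.
elim: k W f => [|k IH] W f Wk kN.
  rewrite -mulrA /= !addr0 ncsM_nil scalar_ratrM -mxscaleAr.
  by rewrite scalar_mxmul -mxscaleAr (ev_stable g Wk kN) /= addr0.
have -> : ev k.+1 (f * g) = ratr (f [::]) *: ev k.+1 g
    + \sum_b letter_mx b * ev k (left_deriv b f * g).
  rewrite /= ncsM_nil scalar_ratrM scalerDr -addrA; congr (_ + _).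
  rewrite scaler_sumr -big_split; apply: eq_bigr => b _ /=.
  rewrite -nc_mulE left_deriv_mul ev_is_additive evZ mulrDr -mxscaleAr.
  by [].
rewrite [ev k.+1 f]/= !mulrDr mulrDl; congr (_ + _).
  by rewrite -mulrA scalar_mxmul -!mxscaleAr (ev_stable g Wk kN).
rewrite !mulr_sumr mulr_suml; apply: eq_bigr => b _.
by rewrite !mulrA IH ?(ltnW kN) //; apply: kills_letter.
Qed.

Variable N : nat.
Hypothesis words0 : forall w, (N < size w)%N -> word_mx w = 0.

Lemma evM f g : ev N (f * g) = ev N f * ev N g.
Proof.
rewrite -[LHS]mul1r (ev_mul_kills (N:=N)) ?mul1r // => w wN.
by rewrite words0 ?mulr0.
Qed.

Lemma ev_expr f k : ev N (f ^+ k) = ev N f ^+ k.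
Proof. by elim: k => [|k IH]; rewrite ?expr0 ?ev1 // !exprS evM IH. Qed.

Lemma ev_nilp f : low 1 f -> ev N f ^+ N.+1 = 0.
Proof.
move=> lf; rewrite -ev_expr; apply: ev_low.
by rewrite -[X in low X _]muln1; apply: low_exp.
Qed.

End Evaluation.

Lemma expr_eq0_leq (R : pzSemiRingType) (x : R) a b :
  x ^+ a = 0 -> (a <= b)%N -> x ^+ b = 0.
Proof. by move=> xa ab; rewrite -(subnK ab) exprD xa mulr0. Qed.

(** The minimal polynomial divides 'X^N, so it is a power of 'X, of degree at
    most n by the Cayley-Hamilton theorem. *)
Lemma mx_nilp (L : fieldType) n (A : 'M[L]_n) N : A ^+ N = 0 -> A ^+ n = 0.
Proof.
case: n A => [|n] A AN; first exact: flatmx0.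
have dN : mxminpoly A %| ('X - 0%:P) ^+ N.
  by rewrite subr0 dvd_mxminpoly rmorphXn /= horner_mx_X AN.
have /dvdp_exp_XsubCP[k _ eqk] := dN.
have kn : (k <= n.+1)%N.
  have := dvdp_leq (monic_neq0 (char_poly_monic A)) (mxminpoly_dvd_char A).
  by rewrite (eqp_size eqk) size_exp_XsubC size_char_poly.
have : mxminpoly A %| 'X^k by rewrite (eqp_dvdl _ eqk) subr0.
rewrite dvd_mxminpoly rmorphXn /= horner_mx_X => /eqP Ak.
exact: expr_eq0_leq Ak kn.
Qed.

(** This is why the sums in [nilp_exp] and [unip_log] can stop at n, whatever
    the length from which products of several matrices vanish. *)
Lemma nilp_sum (L : fieldType) n (A : 'M[L]_n) N (c : nat -> L) :
  A ^+ N = 0 -> \sum_(k < n) c k *: A ^+ k = \sum_(k < N) c k *: A ^+ k.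
Proof.
have widen a b : (a <= b)%N -> A ^+ a = 0 ->
    \sum_(k < a) c k *: A ^+ k = \sum_(k < b) c k *: A ^+ k.
  move=> ab Aa; rewrite (big_ord_widen _ (fun k => c k *: A ^+ k) ab)
    big_mkcond.
  apply: eq_bigr => k _; case: ifPn => //; rewrite -leqNgt => ak.
  by rewrite (expr_eq0_leq Aa ak) scaler0.
move=> AN; have [nN|/ltnW Nn] := leqP n N; last exact/esym/widen.
exact: widen (mx_nilp AN).
Qed.

Section MatrixBCH.
Variables (L : numFieldType) (n : nat) (X Y : 'M[L]_n) (N : nat).
Hypothesis words0 : forall w, (N < size w)%N -> word_mx X Y w = 0.

Local Notation ev := (ev X Y N).

Lemma ev_exp f : low 1 f -> ev (nc_exp f) = nilp_exp (ev f).
Proof.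
move=> lf; rewrite (ev_eqlow X Y (nc_exp_dpow (N:=N) lf)) ev_sum /nilp_exp.
rewrite (nilp_sum (fun k => (k`!%:R)^-1) (ev_nilp words0 lf)).
by apply: eq_bigr => k _; rewrite evZ ev_expr // fmorphV rmorph_nat.
Qed.

Lemma ev_log f : low 1 (f - 1) -> ev (nc_log f) = unip_log (ev f).
Proof.
move=> lf; have := nc_log_eqlow (N:=N) lf;
  rewrite (horner_algE _ (size_poly _ _)).
move/(ev_eqlow X Y)->; rewrite ev_sum /unip_log.
have -> : ev f - 1%:M = ev (f - 1) by rewrite evB ev1.
pose c k : L := (-1) ^+ k.+1 / k%:R.
transitivity (\sum_(k < n) c k *: ev (f - 1) ^+ k).
  rewrite (nilp_sum c (ev_nilp words0 lf)); apply: eq_bigr => k _.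
  rewrite evZ ev_expr // coef_poly ltn_ord /c rmorphM fmorphV rmorph_nat.
  by rewrite rmorphXn rmorphN rmorph1.
rewrite -(big_mkord xpredT (fun k => c k *: ev (f - 1) ^+ k)).
have drop0 m (G : nat -> 'M[L]_n) : G 0%N = 0 ->
    \sum_(0 <= k < m) G k = \sum_(1 <= k < m) G k.
  case: m => [|m] G0; first by rewrite !big_geq.
  by rewrite big_ltn // G0 add0r.
by rewrite drop0 // /c invr0 mulr0 scale0r.
Qed.

Lemma ev_var_pos b : (0 < N)%N -> ev (nc_var b) = letter_mx X Y b.
Proof. by case: N => // N' _; apply: ev_var. Qed.

Lemma ev_exp_var b : (0 < N)%N ->
  ev (nc_exp (nc_var b)) = nilp_exp (letter_mx X Y b).
Proof. by move=> N0; rewrite ev_exp ?ev_var_pos //; apply: low_var. Qed.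

Lemma nilp_exp_bch : (0 < N)%N ->
  nilp_exp X *m nilp_exp Y = nilp_exp (ev bch).
Proof.
move=> N0; rewrite -ev_exp; last exact: bch_low.
by rewrite nc_exp_bch evM // !ev_exp_var.
Qed.

Lemma unip_log_exp f : low 1 f -> unip_log (nilp_exp (ev f)) = ev f.
Proof.
move=> lf; rewrite -ev_exp // -ev_log; last exact: (nc_exp_low lf).
by rewrite nc_log_exp.
Qed.

Lemma ev_lie_eval c : (0 < N)%N -> ev (lie_eval c) = commutator_mx X Y c.
Proof.
move=> N0; elim: c => [||c IHc d IHd].
- exact: (ev_var_pos false).
- exact: (ev_var_pos true).
rewrite /commutator_mx /= -/(commutator_mx X Y c) -/(commutator_mx X Y d).
have evMm f g : ev (f * g) = ev f *m ev g := evM words0 f g.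
by rewrite -IHc -IHd /lie_bracket -!evMm -evB.
Qed.

Lemma commutator_mx0 c : (0 < N)%N -> (N < commutator_length c)%N ->
  commutator_mx X Y c = 0.
Proof.
move=> N0 Nc; rewrite -ev_lie_eval //; apply: ev_low => w wN.
by rewrite lie_eval_hom // ltn_eqF // (leq_trans wN).
Qed.

(** The only degrees that matter are those at most N, as [ev] ignores longer
    words. *)
Lemma ev_bch B : (0 < N)%N -> bch_expression B ->
  ev bch = \sum_(m < N.+1) \sum_(t <- B m) ratr t.1 *: commutator_mx X Y t.2.
Proof.
move=> N0 BE; rewrite (ev_eqlow X Y (bch_eq_sum (N:=N) BE)) ev_sum.
apply: eq_bigr => m _; rewrite ev_sum; apply: eq_bigr => t _.
by rewrite evZ ev_lie_eval.
Qed.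

End MatrixBCH.

(** * Formulas read over two fields at once *)

Module Oqe := ordered_qelim.ord.

Section Satisfaction.
Variable L : realDomainType.
Implicit Types (e : nat -> L) (f : Oqe.formula L) (t : GRing.term L).

(** Formulas are evaluated in environments indexed by all the variables;
    this avoids padding finite sequences. *)
Definition env_set e i x : nat -> L := fun j => if j == i then x else e j.

Fixpoint term_val e t : L :=
  match t with
  | GRing.Var i => e i
  | GRing.Const c => c
  | GRing.NatConst k => k%:R
  | GRing.Add u v => term_val e u + term_val e v
  | GRing.Opp u => - term_val e u
  | GRing.NatMul u k => term_val e u *+ k
  | GRing.Mul u v => term_val e u * term_val e v
  | GRing.Inv u => (term_val e u)^-1
  | GRing.Exp u k => term_val e u ^+ k
  end.

Fixpoint sat e f : Prop :=
  match f with
  | Oqe.Bool b => b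
  | Oqe.Equal u v => term_val e u = term_val e v
  | Oqe.Lt u v => term_val e u < term_val e v
  | Oqe.Le u v => term_val e u <= term_val e v
  | Oqe.Unit u => term_val e u \is a GRing.unit
  | Oqe.And p q => sat e p /\ sat e q
  | Oqe.Or p q => sat e p \/ sat e q
  | Oqe.Implies p q => sat e p -> sat e q
  | Oqe.Not p => ~ sat e p
  | Oqe.Exists i p => exists x, sat (env_set e i x) p
  | Oqe.Forall i p => forall x, sat (env_set e i x) p
  end.

Lemma eval_term_val (s : seq L) t : GRing.eval s t = term_val (nth 0 s) t.
Proof. by elim: t => //= [u -> v ->|u ->|u -> k|u -> v ->|u ->|u -> k]. Qed.

Lemma nth_env_set (s : seq L) i x :
  nth 0 (set_nth 0 s i x) = env_set (nth 0 s) i x.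
Proof. by apply/funext => j; rewrite nth_set_nth. Qed.

Lemma holds_sat (s : seq L) f : Oqe.holds s f <-> sat (nth 0 s) f.
Proof.
elim: f s => //= [u v|u v|u v|u|p IHp q IHq|p IHp q IHq|p IHp q IHq|p IHp
  |i p IHp|i p IHp] s.
1-4: by rewrite !eval_term_val.
1-3: by rewrite IHp IHq.
- by rewrite IHp.
- split=> -[x h]; exists x.
    by rewrite -nth_env_set; apply: (proj1 (IHp _)).
  by apply: (proj2 (IHp _)); rewrite nth_env_set.
split=> h x; first by rewrite -nth_env_set; apply: (proj1 (IHp _)).
by apply: (proj2 (IHp _)); rewrite nth_env_set.
Qed.

(** Free and bound variables are both counted, so that the variables from this
    bound on are fresh. *)
Fixpoint ub_formula f : nat :=
  match f with
  | Oqe.Bool b => 0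
  | Oqe.Equal u v | Oqe.Lt u v | Oqe.Le u v =>
    maxn (GRing.ub_var u) (GRing.ub_var v)
  | Oqe.Unit u => GRing.ub_var u
  | Oqe.And p q | Oqe.Or p q | Oqe.Implies p q =>
    maxn (ub_formula p) (ub_formula q)
  | Oqe.Not p => ub_formula p
  | Oqe.Exists i p | Oqe.Forall i p => maxn i.+1 (ub_formula p)
  end.

Lemma eq_term_val N e e' t : (GRing.ub_var t <= N)%N ->
  (forall i, (i < N)%N -> e i = e' i) -> term_val e t = term_val e' t.
Proof.
move=> tN ee; elim: t tN => //=
  [u IHu v IHv|u IHu|u IHu k|u IHu v IHv|u IHu|u IHu k].
- by rewrite geq_max => /andP[uN vN]; rewrite IHu ?IHv.
- by move=> uN; rewrite IHu.
- by move=> uN; rewrite IHu.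
- by rewrite geq_max => /andP[uN vN]; rewrite IHu ?IHv.
- by move=> uN; rewrite IHu.
by move=> uN; rewrite IHu.
Qed.

Lemma sat_agree N f : (ub_formula f <= N)%N -> forall e e',
  (forall i, (i < N)%N -> e i = e' i) -> sat e f -> sat e' f.
Proof.
have set_eq e e' i x : (forall j, (j < N)%N -> e j = e' j) ->
    forall j, (j < N)%N -> env_set e i x j = env_set e' i x j.
  by move=> ee j jN; rewrite /env_set; case: ifP => // _; apply: ee.
elim: f => //= [u v|u v|u v|u|p IHp q IHq|p IHp q IHq|p IHp q IHq|p IHp
  |i p IHp|i p IHp];
  rewrite ?geq_max.
- by move=> /andP[uN vN] e e' ee; rewrite !(@eq_term_val N e e').
- by move=> /andP[uN vN] e e' ee; rewrite !(@eq_term_val N e e').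
- by move=> /andP[uN vN] e e' ee; rewrite !(@eq_term_val N e e').
- by move=> uN e e' ee; rewrite !(@eq_term_val N e e').
- by move=> /andP[pN qN] e e' ee [hp hq]; split; [exact: IHp hp|exact: IHq hq].
- by move=> /andP[pN qN] e e' ee [hp|hq];
  [left; exact: IHp hp|right; exact: IHq hq].
- move=> /andP[pN qN] e e' ee h hp; apply: (IHq qN _ _ ee); apply: h.
  by apply: IHp hp => // i iN; rewrite ee.
- by move=> pN e e' ee h hp; apply: h; apply: IHp hp => // i iN; rewrite ee.
- by move=> /andP[_ pN] e e' ee [x hx]; exists x; apply: IHp hx => //;
  apply: set_eq.
- by move=> /andP[_ pN] e e' ee h x; apply: IHp (h x) => //; apply: set_eq.
Qed.

Definition env_block e s m (v : nat -> L) : nat -> L :=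
  fun j => if (s <= j < s + m)%N then v (j - s)%N else e j.

Lemma env_block0 e s v : env_block e s 0 v = e.
Proof.
by apply/funext => j; rewrite /env_block addn0; case: ltnP;
  rewrite ?andbF // => ->.
Qed.

Lemma env_blockS e s m x v :
  env_block (env_set e s x) s.+1 m v
  = env_block e s m.+1 (fun j => if j is j'.+1 then v j' else x).
Proof.
apply/funext => j; rewrite /env_block /env_set addSnnS.
case: ltngtP => [sj|js|<-]; rewrite /= ?ltnn //;
  last by rewrite subnn addnS ltnS leq_addr.
by case: ifP => // _; rewrite -(subnSK sj).
Qed.

End Satisfaction.

Lemma ub_map_term (K R : realDomainType) (iota : K -> R) t :
  GRing.ub_var (map_term iota t) = GRing.ub_var t.
Proof. by elim: t => //= [u -> v ->|u -> v ->]. Qed.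

Lemma ub_map_formula (K R : realDomainType) (iota : K -> R) f :
  ub_formula (map_formula iota f) = ub_formula f.
Proof.
by elim: f => //= [u v|u v|u v|u|p -> q ->|p -> q ->|p -> q ->|i p ->|i p ->];
  rewrite ?ub_map_term.
Qed.

Section Codefinable.
Variables (K R : rcfType) (iota : {rmorphism K -> R}).

Definition coterm (s : (nat -> K) -> K) (t : (nat -> R) -> R) :=
  exists u, (forall e, term_val e u = s e)
    /\ (forall e, term_val e (map_term iota u) = t e).

(** Pairs of predicates defined by one formula, read over K and over R: as they
    are closed under the logical operations, neither formulas nor their images
    under [map_formula] need to be written down. *)
Definition codef (p : (nat -> K) -> Prop) (q : (nat -> R) -> Prop) :=
  exists f, (forall e, sat e f <-> p e)
    /\ (forall e, sat e (map_formula iota f) <-> q e).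

Lemma coterm_var i : coterm (fun e => e i) (fun e => e i).
Proof. by exists (GRing.Var K i). Qed.

Lemma coterm_mul s t s' t' : coterm s t -> coterm s' t' ->
  coterm (fun e => s e * s' e) (fun e => t e * t' e).
Proof.
move=> [u [us ut]] [v [vs vt]]; exists (GRing.Mul u v).
by split=> e /=; rewrite ?us ?vs ?ut ?vt.
Qed.

Lemma coterm_sum (I : Type) (r : seq I) s t : (forall i, coterm (s i) (t i)) ->
  coterm (fun e => \sum_(i <- r) s i e) (fun e => \sum_(i <- r) t i e).
Proof.
move=> st; elim: r => [|i r [v [vs vt]]].
  by exists (GRing.NatConst K 0); split=> e; rewrite big_nil.
have [u [us ut]] := st i; exists (GRing.Add u v).
by split=> e /=; rewrite big_cons ?us ?vs ?ut ?vt.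
Qed.

Lemma codef_eq s t s' t' : coterm s t -> coterm s' t' ->
  codef (fun e => s e = s' e) (fun e => t e = t' e).
Proof.
move=> [u [us ut]] [v [vs vt]]; exists (Oqe.Equal u v).
by split=> e /=; rewrite ?us ?vs ?ut ?vt.
Qed.

Lemma codef_formula f :
  codef (fun e => sat e f) (fun e => sat e (map_formula iota f)).
Proof. by exists f. Qed.

Lemma codef_and p q p' q' : codef p q -> codef p' q' ->
  codef (fun e => p e /\ p' e) (fun e => q e /\ q' e).
Proof.
move=> [u [up uq]] [v [vp vq]]; exists (Oqe.And u v).
by split=> e /=; rewrite ?up ?vp ?uq ?vq.
Qed.

Lemma codef_all (I : eqType) (r : seq I) p q : (forall i, codef (p i) (q i)) ->
  codef (fun e => forall i, i \in r -> p i e)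
    (fun e => forall i, i \in r -> q i e).
Proof.
move=> pq; elim: r => [|i r [v [vp vq]]].
  by exists (Oqe.Bool true); split=> e /=; split.
have [u [up uq]] := pq i; exists (Oqe.And u v).
have all_cons (P : I -> Prop) : (forall j, j \in i :: r -> P j) <->
    P i /\ forall j, j \in r -> P j.
  split=> [h|[hi h] j]; last by rewrite inE => /predU1P[->//|]; apply: h.
  by split=> [|j jr]; apply: h; rewrite inE ?eqxx ?jr ?orbT.
by split=> e /=; rewrite all_cons ?up ?uq ?vp ?vq.
Qed.

Lemma codef_all_ord m p q : (forall i : 'I_m, codef (p i) (q i)) ->
  codef (fun e => forall i, p i e) (fun e => forall i, q i e).
Proof.
move=> pq; have [f [fp fq]] := codef_all (enum 'I_m) pq; exists f.
split=> e; rewrite ?fp ?fq; split=> h i; do ?[by apply: h; rewrite mem_enum].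
  by move=> _; apply: h.
by move=> _; apply: h.
Qed.

Lemma codef_block s m p q : codef p q ->
  codef (fun e => exists v, p (env_block e s m v))
        (fun e => exists v, q (env_block e s m v)).
Proof.
elim: m s => [|m IH] s pq.
  have [f [fp fq]] := pq; exists f.
  by split=> e; rewrite ?fp ?fq; split=> [h|[v]]; rewrite ?env_block0 //;
    exists (fun=> 0); rewrite env_block0.
have [f [fp fq]] := IH s.+1 pq; exists (Oqe.Exists s f).
split=> e /=; split.
- by move=> [x /fp[v pv]]; rewrite env_blockS in pv; eexists; exact: pv.
- move=> [v pv]; exists (v 0%N); apply/fp; exists (fun j => v j.+1).
  rewrite env_blockS; congr p: pv; congr (env_block _ _ _ _).
  by apply/funext => -[].
- by move=> [x /fq[v pv]]; rewrite env_blockS in pv; eexists; exact: pv.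
- move=> [v pv]; exists (v 0%N); apply/fq; exists (fun j => v j.+1).
  rewrite env_blockS; congr q: pv; congr (env_block _ _ _ _).
  by apply/funext => -[].
Qed.

End Codefinable.

(** * Stability of semialgebraic extensions under conjugation *)

Section Conjugation.
Variables (n p : nat).
Hypothesis np : (n * n <= p)%N.
Let m := (n * n)%N.

Definition mx_env (L : rcfType) (z : 'M[L]_n) : nat -> L :=
  nth 0 [seq mxvec z 0 i | i <- enum 'I_m].

Lemma mx_envE (L : rcfType) (z : 'M[L]_n) (i : 'I_m) : mx_env z i = mxvec z 0 i.
Proof. by rewrite /mx_env (nth_map i) ?size_enum_ord // nth_ord_enum. Qed.

Lemma mx_env_out (L : rcfType) (z : 'M[L]_n) j : (m <= j)%N -> mx_env z j = 0.
Proof. by move=> mj; rewrite /mx_env nth_default // size_map size_enum_ord. Qed.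

Lemma mxholdsE (L : rcfType) f (z : 'M[L]_n) : mxholds f z <-> sat (mx_env z) f.
Proof. exact: holds_sat. Qed.

Local Notation idx i j := (nat_of_ord (mxvec_index i j)).

(** Copying the matrix to the variables 0, ..., m - 1, which f reads, takes the
    place of a substitution. *)
Definition sat_at (L : rcfType) s (f : Oqe.formula L) (e : nat -> L) :=
  exists u, let e' := env_block e 0 m u in
    (forall i : 'I_m, e' i = e' (s + i)%N) /\ sat e' f.

(** The matrices x and y are stored in two blocks of variables from p on,
    where neither f1 nor f2 looks. *)
Definition conj_pred (L : rcfType) (f1 f2 : Oqe.formula L) (e0 : nat -> L) :=
  exists v, let e1 := env_block e0 p m v in
  exists w, let e := env_block e1 (p + m) m w in
    (forall i j : 'I_n,
       \sum_(k < n) e (idx i k) * e (p + idx k j)%N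
       = \sum_(k < n) e (p + idx i k)%N * e (p + m + idx k j)%N)
    /\ (sat_at p f1 e /\ sat_at (p + m) f2 e).

Lemma codef_conj (K R : rcfType) (iota : {rmorphism K -> R}) f1 f2 :
  codef iota (conj_pred f1 f2)
    (conj_pred (map_formula iota f1) (map_formula iota f2)).
Proof.
have at_ s f : codef iota (sat_at s f) (sat_at s (map_formula iota f)).
  apply: (codef_block 0 m
    (p := fun e => (forall i : 'I_m, e i = e (s + i)%N) /\ sat e f)
    (q := fun e => (forall i : 'I_m, e i = e (s + i)%N)
                   /\ sat e (map_formula iota f))).
  apply: codef_and; last exact: codef_formula.
  by apply: codef_all_ord => i; apply: codef_eq; apply: coterm_var.
pose body (L : rcfType) (f1 f2 : Oqe.formula L) (e : nat -> L) :=
  (forall i j : 'I_n,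
       \sum_(k < n) e (idx i k) * e (p + idx k j)%N
       = \sum_(k < n) e (p + idx i k)%N * e (p + m + idx k j)%N)
    /\ (sat_at p f1 e /\ sat_at (p + m) f2 e).
have cb : codef iota (body K f1 f2)
    (body R (map_formula iota f1) (map_formula iota f2)).
  apply: codef_and; last by apply: codef_and.
  apply: codef_all_ord => i; apply: codef_all_ord => j; apply: codef_eq;
  by apply: coterm_sum => k; apply: coterm_mul; apply: coterm_var.
exact: (codef_block p m (codef_block (p + m) m cb)).
Qed.

(** Unlike the block that f reads, the variables between m and p must still
    be 0, as they are when f is evaluated at a matrix; those from p on are
    fresh for f. *)
Lemma sat_atE (L : rcfType) s (f : Oqe.formula L) (x : 'M[L]_n) (e : nat -> L) :
  (ub_formula f <= p)%N -> (m <= s)%N ->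
  (forall j, (m <= j < p)%N -> e j = 0) ->
  (forall i : 'I_m, e (s + i)%N = mxvec x 0 i) ->
  sat_at s f e <-> mxholds f x.
Proof.
move=> fp ms e0 ex; rewrite mxholdsE.
have out u j : (m <= j)%N -> env_block e 0 m u j = e j.
  by move=> mj; rewrite /env_block add0n ltnNge mj.
have in_ u (i : 'I_m) : env_block e 0 m u i = u i.
  by rewrite /env_block /= add0n ltn_ord subn0.
have agree (u : nat -> L) : (forall i : 'I_m, u i = mxvec x 0 i) ->
    forall j, (j < p)%N -> env_block e 0 m u j = mx_env x j.
  move=> ux j jp; have [jm|mj] := ltnP j m.
    by rewrite (in_ u (Ordinal jm)) ux (mx_envE x (Ordinal jm)).
  by rewrite out // e0 ?mj // mx_env_out.
split=> [[u [eu hu]]|hx].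
  refine (sat_agree fp _ hu); apply: agree => i.
  by rewrite -(in_ u i) eu out ?ex // (leq_trans ms) ?leq_addr.
exists (mx_env x); split=> [i|].
  by rewrite in_ out ?ex ?mx_envE // (leq_trans ms) ?leq_addr.
refine (sat_agree fp _ hx) => j jp; apply/esym/agree => // i; exact: mx_envE.
Qed.

Definition mx_of_env (L : rcfType) (v : nat -> L) : 'M[L]_n :=
  vec_mx (\row_(i < m) v i).

Lemma mx_of_envE (L : rcfType) (v : nat -> L) i : mxvec (mx_of_env v) 0 i = v i.
Proof. by rewrite /mx_of_env vec_mxK mxE. Qed.

Lemma conj_predE (L : rcfType) (f1 f2 : Oqe.formula L) (z : 'M[L]_n) :
  (ub_formula f1 <= p)%N -> (ub_formula f2 <= p)%N ->
  conj_pred f1 f2 (mx_env z) <->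
  exists x y, [/\ z *m x = x *m y, mxholds f1 x & mxholds f2 y].
Proof.
move=> f1p f2p.
have key (v w : nat -> L) (x y : 'M[L]_n) :
    (forall i : 'I_m, v i = mxvec x 0 i) ->
    (forall i : 'I_m, w i = mxvec y 0 i) ->
    let e := env_block (env_block (mx_env z) p m v) (p + m) m w in
    [/\ forall i : 'I_m, e i = mxvec z 0 i,
        forall i : 'I_m, e (p + i)%N = mxvec x 0 i,
        forall i : 'I_m, e (p + m + i)%N = mxvec y 0 i
      & forall j, (m <= j < p)%N -> e j = 0].
  have nlt j : (j < p)%N -> ((p + m <= j) = false)%N * ((p <= j) = false)%N.
    by move=> jp; rewrite !(leqNgt _ j) jp (leq_trans jp) ?leq_addr.
  move=> vx wy; split=> [i|i|i|j /andP[mj jp]]; rewrite /env_block.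
  - have ip : (i < p)%N := leq_trans (ltn_ord i) np.
    by rewrite !nlt // mx_envE.
  - rewrite leqNgt ltn_add2l ltn_ord /= leq_addr /=.
    by rewrite addKn vx.
  - by rewrite leq_addr ltn_add2l ltn_ord /= addKn wy.
  by rewrite !nlt // mx_env_out.
have mxeq (x y : 'M[L]_n) (e : nat -> L) :
    (forall i : 'I_m, e i = mxvec z 0 i) ->
    (forall i : 'I_m, e (p + i)%N = mxvec x 0 i) ->
    (forall i : 'I_m, e (p + m + i)%N = mxvec y 0 i) ->
    (forall i j : 'I_n, \sum_(k < n) e (idx i k) * e (p + idx k j)%N
       = \sum_(k < n) e (p + idx i k)%N * e (p + m + idx k j)%N)
    <-> z *m x = x *m y.
  move=> ez ex ey; split=> [h|/matrixP h].
    apply/matrixP => i j; rewrite !mxE; have := h i j.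
    under eq_bigr do rewrite ez ex !mxvecE.
    by under [RHS]eq_bigr do rewrite ex ey !mxvecE.
  move=> i j; under eq_bigr do rewrite ez ex !mxvecE.
  under [RHS]eq_bigr do rewrite ex ey !mxvecE.
  by have := h i j; rewrite !mxE.
split=> [[v [w [eqs [s1 s2]]]]|[x [y [zx s1 s2]]]].
  have [ez ex ey e0] := key v w (mx_of_env v) (mx_of_env w)
    (fun i => esym (mx_of_envE v i)) (fun i => esym (mx_of_envE w i)).
  exists (mx_of_env v), (mx_of_env w); split.
  - exact: (proj1 (mxeq _ _ _ ez ex ey)).
  - exact: (proj1 (sat_atE f1p np e0 ex)).
  - exact: (proj1 (sat_atE f2p (leq_trans np (leq_addr _ _)) e0 ey)).
have [ez ex ey e0] := key (mx_env x) (mx_env y) x y (mx_envE x) (mx_envE y).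
exists (mx_env x), (mx_env y); split;
  first exact: (proj2 (mxeq _ _ _ ez ex ey)).
split; first exact: (proj2 (sat_atE f1p np e0 ex)).
exact: (proj2 (sat_atE f2p (leq_trans np (leq_addr _ _)) e0 ey)).
Qed.

End Conjugation.

(** Over K the formula of [codef_conj] defines G again, because G is a group,
    and over R it holds at z by its very meaning. *)
Lemma sa_extension_conj (K R : rcfType) (iota : {rmorphism K -> R}) n
    (G : set 'M[K]_n) x y z : matrix_group G ->
  sa_extension iota G x -> sa_extension iota G y -> z *m x = x *m y ->
  sa_extension iota G z.
Proof.
move=> [Gu G1 GM GV] [f1 f1G f1x] [f2 f2G f2y] zx.
pose p := maxn (n * n) (maxn (ub_formula f1) (ub_formula f2)).
have np : (n * n <= p)%N by rewrite leq_maxl.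
have f1p : (ub_formula f1 <= p)%N by rewrite leq_max leq_maxl orbT.
have f2p : (ub_formula f2 <= p)%N by rewrite leq_max leq_maxr orbT.
have [f [fK fR]] := codef_conj n p iota f1 f2.
exists f.
  apply/seteqP; split=> h.
    (* Conjugation by the identity. *)
    move=> Gh; apply/mxholdsE/fK/(conj_predE np) => //; exists 1%:M, h.
    rewrite mulmx1 mul1mx; split=> //; first by rewrite f1G in G1.
    by rewrite f2G in Gh.
  move=> /mxholdsE/fK/(conj_predE np)[]// a [b [hab ha hb]].
  have Ga : G a by rewrite f1G.
  have Gb : G b by rewrite f2G.
  rewrite -[h]mulmx1 -(mulmxV (Gu _ Ga)) mulmxA hab.
  exact: (GM _ _ (GM _ _ Ga Gb) (GV _ Ga)).
apply/mxholdsE/fR/(conj_predE np); rewrite ?ub_map_formula //.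
by exists x, y.
Qed.

(** * The tangent space is closed under brackets *)

Section MatrixCurves.
Variables (R : realType) (x0 : R).

Lemma is_derive_bigsum (I : Type) (r : seq I) (f : I -> R -> R) (df : I -> R) :
  (forall i, is_derive x0 1 (f i) (df i)) ->
  is_derive x0 1 (fun t => \sum_(i <- r) f i t) (\sum_(i <- r) df i).
Proof.
move=> fd; elim: r => [|i r IH].
  rewrite big_nil; under eq_fun do rewrite big_nil; exact: is_derive_cst.
rewrite big_cons; under eq_fun do rewrite big_cons; exact: is_deriveD.
Qed.

Lemma derivable_bigprod (I : Type) (r : seq I) (f : I -> R -> R) :
  (forall i, derivable (f i) x0 1) ->
  derivable (fun t => \prod_(i <- r) f i t) x0 1.
Proof.
move=> fd; elim: r => [|i r IH].
  by under eq_fun do rewrite big_nil; exact: derivable_cst.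
by under eq_fun do rewrite big_cons; exact: derivableM.
Qed.

Lemma derivable_bigsum (I : Type) (r : seq I) (f : I -> R -> R) :
  (forall i, derivable (f i) x0 1) ->
  derivable (fun t => \sum_(i <- r) f i t) x0 1.
Proof.
by move=> fd; have [] := is_derive_bigsum r (fun i => derivableP (fd i)).
Qed.

Definition mx_is_derive m n (c : R -> 'M[R]_(m, n)) (X : 'M[R]_(m, n)) :=
  forall i j, is_derive x0 1 (fun t => c t i j) (X i j).

Lemma mx_is_derive_cst m n (A : 'M[R]_(m, n)) : mx_is_derive (fun=> A) 0.
Proof. by move=> i j; rewrite mxE; apply: is_derive_cst. Qed.

Lemma mx_is_deriveM m n p (c : R -> 'M[R]_(m, n)) (d : R -> 'M[R]_(n, p)) X Y :
  mx_is_derive c X -> mx_is_derive d Y ->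
  mx_is_derive (fun t => c t *m d t) (X *m d x0 + c x0 *m Y).
Proof.
move=> cX dY i j; under eq_fun do rewrite mxE.
rewrite !mxE -big_split /=; apply: is_derive_bigsum => k.
apply: is_derive_eq; first exact: is_deriveM.
by rewrite addrC; congr (_ + _); exact: mulrC.
Qed.

Lemma mx_is_derive_unique m n (c : R -> 'M[R]_(m, n)) X Y :
  mx_is_derive c X -> mx_is_derive c Y -> X = Y.
Proof.
move=> cX cY; apply/matrixP => i j.
by have [_ <-] := cX i j; have [_ <-] := cY i j.
Qed.

Lemma derivable_det n (c : R -> 'M[R]_n) :
  (forall i j, derivable (fun t => c t i j) x0 1) ->
  derivable (fun t => \det (c t)) x0 1.
Proof.
move=> cd; apply: derivable_bigsum => s; apply: derivableM;
  first exact: derivable_cst.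
exact: derivable_bigprod.
Qed.

Lemma derivable_adj n (c : R -> 'M[R]_n) i j :
  (forall i j, derivable (fun t => c t i j) x0 1) ->
  derivable (fun t => \adj (c t) i j) x0 1.
Proof.
move=> cd; under eq_fun do rewrite mxE; apply: derivableM;
  first exact: derivable_cst.
apply: derivable_det => k l; under eq_fun do rewrite !mxE; exact: cd.
Qed.

(** The coordinates of [projv g M - M] are linear forms in M which vanish along
    the curve near x0, hence so do their derivatives. *)
Lemma velocity_in_vspace n (g : {vspace 'M[R]_n}) (c : R -> 'M[R]_n) X :
  (\forall t \near x0, c t \in g) -> mx_is_derive c X -> X \in g.
Proof.
move=> cg cX; suff <- : projv g X = X by apply: memv_proj.
pose T (M : 'M[R]_n) := projv g M - M.
have TE (M : 'M[R]_n) i j :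
    T M i j = \sum_k \sum_l M k l * T (delta_mx k l) i j.
  have Tlin : linear T.
    by move=> a A B; rewrite /T linearP scalerBr opprD addrACA.
  pose T' := GRing.isLinear.Build _ _ _ _ T Tlin.
  pose TT : {linear 'M[R]_n -> 'M[R]_n} := HB.pack T T'.
  rewrite -[T]/(TT : _ -> _) {1}[M]matrix_sum_delta linear_sum summxE.
  apply: eq_bigr => k _; rewrite linear_sum summxE; apply: eq_bigr => l _.
  by rewrite linearZ mxE.
apply/eqP; rewrite -subr_eq0 -/(T X); apply/eqP/matrixP => i j.
have d1 : is_derive x0 1 (fun t => T (c t) i j) (T X i j).
  rewrite TE; under eq_fun do rewrite TE.
  apply: is_derive_bigsum => k; apply: is_derive_bigsum => l.
  apply: is_derive_eq; first exact: is_deriveM.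
  by rewrite scaler0 add0r mulrC.
have d2 : is_derive x0 1 (fun t => T (c t) i j) 0.
  apply: near_eq_is_derive (is_derive_cst 0 x0 1).
  by apply: filterS cg => t ct; rewrite /T projv_id // subrr mxE.
by have [_ <-] := d1; have [_ ->] := d2; rewrite mxE.
Qed.

End MatrixCurves.

(** For t near 0, conjugation by c(t) maps curves of E to curves of E, so it
    preserves g.  Replacing the inverse of c(t) by its adjugate, which only
    changes the result by a scalar, makes all the entries polynomial in those
    of c(t).  The velocity of the adjugate is D - X with D a scalar matrix, as
    one sees by differentiating adj(c(t)) c(t) = det(c(t)). *)
Lemma is_lie_algebra_bracket (R : realType) n (E : set 'M[R]_n)
    (g : {vspace 'M[R]_n}) X Y :
  (forall x y z, E x -> E y -> z *m x = x *m y -> E z) ->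
  is_lie_algebra E g -> X \in g -> Y \in g -> lie_bracket X Y \in g.
Proof.
move=> Econj gE Xg Yg.
have /gE[c [cE c0 cd cX]] := Xg; have /gE[d [dE d0 dd dY]] := Yg.
have {}cX : mx_is_derive 0 c X.
  by move=> i j; rewrite -cX derive1E; apply: derivableP.
have conj_g t : c t \in unitmx -> c t *m Y *m invmx (c t) \in g.
  move=> ct; pose k s := c t *m d s *m invmx (c t).
  have kd s Z : mx_is_derive s d Z ->
      mx_is_derive s k (c t *m Z *m invmx (c t)).
    move=> dZ; have := mx_is_deriveM (mx_is_deriveM
      (mx_is_derive_cst s (c t)) dZ) (mx_is_derive_cst s (invmx (c t))).
    by rewrite mul0mx add0r mulmx0 addr0.
  have dD s : mx_is_derive s d (\matrix_(i, j) 'D_1 (fun u => d u i j) s).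
    by move=> i j; rewrite mxE; apply: derivableP.
  apply/gE; exists k; split.
  - by move=> s; apply: (Econj (c t) (d s)) => //; rewrite /k mulmxKV.
  - by rewrite /k d0 mulmx1 mulmxV.
  - by move=> s i j; have [] := kd s _ (dD s) i j.
  move=> i j; rewrite derive1E; have [_ ->] := kd 0 _ (dD 0) i j.
  congr ((_ *m _ *m _) i j); apply/matrixP => a b.
  by rewrite mxE -derive1E; exact: dY.
have det_d : derivable (fun t => \det (c t)) 0 1 by apply: derivable_det.
have near_g : \forall t \near (0 : R), c t *m Y *m \adj (c t) \in g.
  have : \forall t \near (0 : R), \det (c t) != 0.
    have dcont : {for (0 : R), continuous (fun t => \det (c t))}.
      exact/differentiable_continuous/derivable1_diffP.
    by apply: (cvgr_neq0 _ dcont); rewrite c0 det1 oner_neq0.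
  apply: filterS => t dt; have ct : c t \in unitmx by rewrite unitmxE unitfE.
  by rewrite -[\adj _]scale1r -(mulfV dt) -scalerA -scalemxAr;
    rewrite memvZ //; have := conj_g t ct; rewrite /invmx ct.
pose D := 'D_1 (fun t => \det (c t)) (0 : R).
pose V : 'M[R]_n := \matrix_(i, j) 'D_1 (fun t => \adj (c t) i j) (0 : R).
have adjV : mx_is_derive 0 (fun t => \adj (c t)) V.
  by move=> i j; rewrite mxE; apply: derivableP; apply: derivable_adj.
(* Differentiate adj(c(t)) c(t) = det(c(t)) at 0. *)
have VE : V = D%:M - X.
  apply/eqP; rewrite eq_sym subr_eq; apply/eqP.
  have h1 := mx_is_deriveM adjV cX; rewrite c0 mulmx1 adj1 mul1mx in h1.
  apply: mx_is_derive_unique h1 => i j.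
  under eq_fun do rewrite mul_adj_mx mxE.
  rewrite mxE; case: (i == j); rewrite ?mulr1n ?mulr0n; first exact: derivableP.
  exact: is_derive_cst.
have := velocity_in_vspace near_g
  (mx_is_deriveM (mx_is_deriveM cX (mx_is_derive_cst 0 Y)) adjV).
rewrite c0 adj1 !mul1mx mulmx1 addr0 VE mulmxBr mul_mx_scalar.
rewrite addrCA -/(lie_bracket X Y) => h.
have := memvB h (memvZ D Yg).
by rewrite addrAC subrr add0r.
Qed.

(** * The nilradical *)

(** The map which sends H to the values at H of the elements of a basis of the
    dual space is injective, hence bijective by dimension. *)
Lemma dual_basis_point (R : fieldType) (V : vectType R)
    (Delta : seq 'Hom(V, R^o)) :
  basis_of fullv Delta ->
  exists H : V, forall i, (i < size Delta)%N -> Delta`_i H = 1.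
Proof.
move=> bD; pose d := size Delta.
pose phi (H : V) : 'rV[R]_d := \row_(i < d) (Delta`_i H : R).
have phi_lin : linear phi.
  by move=> c H H'; apply/rowP => i; rewrite !mxE linearP.
pose phi' := GRing.isLinear.Build _ _ _ _ phi phi_lin.
pose Phi : {linear V -> 'rV[R]_d} := HB.pack phi phi'.
have ker0 : lker (linfun Phi) = 0%VS.
  apply/eqP/lker0P => H H'; rewrite !lfunE /= => eqH; apply/eqP.
  rewrite -subr_eq0; apply/eqP; set u := H - H'.
  have Du i : (i < d)%N -> Delta`_i u = 0.
    move=> id; rewrite /u linearB /=.
    by have /rowP/(_ (Ordinal id)) := eqH; rewrite !mxE => ->; rewrite subrr.
  have fu (f : 'Hom(V, R^o)) : f u = 0.
    have /(coord_span (X:=in_tuple Delta)) -> : f \in <<in_tuple Delta>>%VS.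
      by rewrite (span_basis bD) memvf.
    by rewrite sum_lfunE big1 // => i _; rewrite scale_lfunE Du ?scaler0.
  rewrite (coord_vbasis (memvf u)) big1 // => i _.
  have := fu (linfun (coord (vbasis fullv) i : V -> R^o)).
  by rewrite lfunE /= => ->; rewrite scale0r.
have dimV : \dim (limg (linfun Phi)) = d.
  transitivity (\dim (fullv : {vspace 'Hom(V, R^o)})).
    by rewrite limg_dim_eq ?ker0 ?capv0 // !dimvf /dim /= muln1.
  exact: (size_basis (X:=in_tuple Delta) bD).
have /memv_imgP[H _ /rowP HE] : const_mx 1 \in limg (linfun Phi).
  suff -> : limg (linfun Phi) = fullv by apply: memvf.
  by apply/eqP; rewrite eqEdim subvf dimV dimvf /dim /= mul1n.
exists H => i id; have := HE (Ordinal id).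
by rewrite lfunE /= !mxE.
Qed.

(** A nonzero polynomial has finitely many roots. *)
Lemma natr_nonroot (R : numDomainType) (p : {poly R}) : p != 0 ->
  exists N, forall k, (N <= k)%N -> ~~ root p k%:R.
Proof.
elim: {p}(size p) {-2}p (leqnn (size p)) => [|m IH] p.
  by rewrite leqn0 size_poly_eq0 => /eqP ->; rewrite eqxx.
move=> pm p0; have [[k rk]|nok] := pselect (exists k : nat, root p k%:R);
  last first.
  by exists 0%N => k _; apply/negP => rk; apply: nok; exists k.
have /factor_theorem[q pE] := rk.
have q0 : q != 0 by apply: contra_neq p0 => q0; rewrite pE q0 mul0r.
have [|N qN] := IH q _ q0.
  by move: pm; rewrite pE size_Mmonic ?monicXsubC // size_XsubC addn2 /= ltnS.
exists (maxn N k.+1) => l; rewrite geq_max => /andP[Nl kl].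
by rewrite pE rootM negb_or qN // root_XsubC eqr_nat eq_sym ltn_eqF.
Qed.

Lemma ad_eigenvalue_bound (R : realType) n (A : 'M[R]_n) :
  exists N, forall k (W : 'M[R]_n), (N <= k)%N ->
    lie_bracket A W = k%:R *: W -> W = 0.
Proof.
pose f (W : 'M[R]_n) := lie_bracket A W.
have flin : linear f.
  move=> c U V; rewrite /f /lie_bracket mulmxDr mulmxDl scalerBr.
  by rewrite -scalemxAl -scalemxAr opprD addrACA.
pose f' := GRing.isLinear.Build _ _ _ _ f flin.
pose ff : {linear 'M[R]_n -> 'M[R]_n} := HB.pack f f'.
have [N Nroot] := natr_nonroot (monic_neq0 (char_poly_monic (lin_mx ff))).
exists N => k W Nk kW; apply/eqP/negPn/negP => W0.
have := Nroot k Nk; rewrite -eigenvalue_root_char => /eigenvalueP; apply.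
exists (mxvec W); last by rewrite mxvec_eq0.
by rewrite mul_vec_lin [X in mxvec X]kW linearZ.
Qed.

Lemma lie_bracket_leibniz (L : fieldType) n (A X Y : 'M[L]_n) :
  lie_bracket A (lie_bracket X Y)
  = lie_bracket (lie_bracket A X) Y + lie_bracket X (lie_bracket A Y).
Proof.
rewrite /lie_bracket !(mulmxBl, mulmxBr) !mulmxA.
move: (A *m X *m Y) (A *m Y *m X) (X *m Y *m A) (Y *m X *m A)
  (X *m A *m Y) (Y *m A *m X) => M1 M2 M3 M4 M5 M6.
by apply/matrixP => i j; rewrite !mxE; ring.
Qed.

Section Nilradical.
Variables (R : realType) (n : nat) (g a : {vspace 'M[R]_n}).
Variables (K F : rcfType) (iKR : {rmorphism K -> R}) (iKF : {rmorphism K -> F}).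
Variable P : set (dual_space a).
Hypothesis P_pos : positive_system (is_root g (a := a)) P.
Hypothesis g_bracket : forall X Y, X \in g -> Y \in g -> lie_bracket X Y \in g.

Lemma mulrn_lfunE (alpha : dual_space a) k H : (alpha *+ k) H = alpha H *+ k.
Proof. by elim: k => [|k IH]; rewrite ?zero_lfunE // !mulrS add_lfunE IH. Qed.

(** The value of a positive root at the point H where all the simple roots
    take the value 1 is the height of the root. *)
Lemma height_exists : exists H : subvs_of a, forall alpha, P alpha ->
  exists2 h, (0 < h)%N & alpha H = h%:R.
Proof.
have [Delta [_ bD _] ->] := P_pos.
have [H H1] := dual_basis_point bD.
exists H => alpha [[alpha0 _] [c aE]].
exists (\sum_(i < size Delta) c i)%N; last first.
  rewrite aE sum_lfunE natr_sum; apply: eq_bigr => i _.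
  by rewrite mulrn_lfunE H1.
rewrite lt0n; apply: contra_neq alpha0 => /eqP;
  rewrite sum_nat_eq0 => /forallP c0.
by rewrite aE big1 // => i _; rewrite (eqP (c0 i)) mulr0n.
Qed.

(** The Jacobi identity adds up the weights; the sum of two positive roots is
    not zero since its height is positive. *)
Lemma root_space_bracket (alpha beta : dual_space a) X Y : P alpha -> P beta ->
  root_space g alpha X -> root_space g beta Y -> lie_bracket X Y != 0 ->
  P (alpha + beta) /\ root_space g (alpha + beta) (lie_bracket X Y).
Proof.
move=> Pa Pb [Xg Xa] [Yg Yb] XY0.
have XYab : root_space g (alpha + beta) (lie_bracket X Y).
  split=> [|H]; first exact: g_bracket.
  rewrite add_lfunE scalerDl.
  transitivity (lie_bracket (lie_bracket (vsval H) X) Y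
              + lie_bracket X (lie_bracket (vsval H) Y)).
    exact: lie_bracket_leibniz.
  rewrite Xa Yb /lie_bracket -!scalemxAl -!scalemxAr -!scalerBr //.
split=> //; have [H hH] := height_exists.
have [ha ha0 aH] := hH _ Pa; have [hb hb0 bH] := hH _ Pb.
have ab0 : alpha + beta != 0.
  apply/eqP => /(congr1 (fun f : dual_space a => f H)) /eqP.
  by rewrite add_lfunE aH bH zero_lfunE -natrD pnatr_eq0 addn_eq0 (gtn_eqF ha0).
have [Delta _ PE] := P_pos; rewrite PE.
have [_ [c cE]] : is_root g alpha /\ nonneg_combination Delta alpha.
  by rewrite PE in Pa.
have [_ [d dE]] : is_root g beta /\ nonneg_combination Delta beta.
  by rewrite PE in Pb.
split; first by split=> //; exists (lie_bracket X Y).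
exists (fun i => (c i + d i)%N); rewrite cE dE -big_split.
by apply: eq_bigr => i _; rewrite mulrnDr.
Qed.

(** Brackets and products are computed on K-rational root vectors, the only
    matrices that make sense both over R, where weights are defined, and over
    F. *)
Definition rational_root_vector (M : 'M[K]_n) :=
  exists2 alpha, P alpha & root_space g alpha (map_mx iKR M).

Definition root_vector_span (X : 'M[F]_n) := exists2 s : seq (F * 'M[K]_n),
  forall t, t \in s -> rational_root_vector t.2
  & X = \sum_(t <- s) t.1 *: map_mx iKF t.2.

Lemma root_vector_span0 : root_vector_span 0.
Proof. by exists [::] => //; rewrite big_nil. Qed.

Lemma root_vector_spanD X Y :
  root_vector_span X -> root_vector_span Y -> root_vector_span (X + Y).
Proof.
move=> [s sP ->] [t tP ->]; exists (s ++ t); last by rewrite big_cat.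
by move=> u; rewrite mem_cat => /orP[/sP|/tP].
Qed.

Lemma root_vector_spanZ c X : root_vector_span X -> root_vector_span (c *: X).
Proof.
move=> [s sP ->]; exists [seq (c * t.1, t.2) | t <- s].
  by move=> _ /mapP[t /sP tP ->].
by rewrite big_map scaler_sumr; apply: eq_bigr => t _; rewrite scalerA.
Qed.

Lemma root_vector_span_gen M :
  rational_root_vector M -> root_vector_span (map_mx iKF M).
Proof.
move=> MP; exists [:: (1, M)]; last by rewrite big_seq1 scale1r.
by move=> t; rewrite inE => /eqP->.
Qed.

Lemma root_vector_span_ind (Q : 'M[F]_n -> Prop) :
  Q 0 ->
  (forall c M Y, rational_root_vector M -> Q Y ->
     Q (c *: map_mx iKF M + Y)) ->
  forall X, root_vector_span X -> Q X.
Proof.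
move=> Q0 QD X [s sP ->]; elim: s sP => [|t s IH] sP; first by rewrite big_nil.
rewrite big_cons; apply: QD; first by apply: sP; rewrite mem_head.
by apply: IH => u us; apply: sP; rewrite inE us orbT.
Qed.

(** From right to left, the terms are added one by one, each to the component
    of its root. *)
Lemma nilradical_span : nilradical_over g iKR iKF P = root_vector_span.
Proof.
apply/seteqP; split=> X.
  move=> [s [Z [_ sP ->]]]; elim: s sP => [|alpha s IH] sP.
    by rewrite big_nil; apply: root_vector_span0.
  rewrite big_cons; apply: root_vector_spanD; last first.
    by apply: IH => beta bs; apply: sP; rewrite inE bs orbT.
  have [Pa [t tP ->]] := sP alpha (mem_head _ _).
  by exists t => // u /tP ut; exists alpha.
elim/root_vector_span_ind: X /.
  by exists [::], (fun=> 0); split=> //; rewrite big_nil.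
move=> c M Y [alpha Pa Ma] [s [Z [us sP ->]]].
pose W := c *: map_mx iKF M.
have aW X : root_space_over g iKR iKF alpha X ->
    root_space_over g iKR iKF alpha (W + X).
  move=> [t tP ->]; exists ((c, M) :: t); last by rewrite big_cons.
  by move=> u; rewrite inE => /predU1P[->//|/tP].
pose Z' beta := if beta == alpha
  then W + (if alpha \in s then Z alpha else 0) else Z beta.
have Z'E (r : seq (dual_space a)) : alpha \notin r ->
    \sum_(beta <- r) Z' beta = \sum_(beta <- r) Z beta.
  move=> ar; apply: eq_big_seq => beta br; rewrite /Z'.
  by case: eqP => // ba; rewrite -ba br in ar.
have [as_|as_] := boolP (alpha \in s).
  exists s, Z'; split=> // [beta bs|].
    rewrite /Z' as_; case: eqP => [->|_]; last exact: sP.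
    by split=> //; apply: aW; have [] := sP _ as_.
  rewrite (bigD1_seq alpha) //= [RHS](bigD1_seq alpha) //= addrA.
  have -> : Z' alpha = W + Z alpha by rewrite /Z' eqxx as_.
  congr (_ + _).
  by apply: eq_bigr => beta /negbTE ba; rewrite /Z' ba.
exists (alpha :: s), Z'; split; first by rewrite /= as_.
  move=> beta; rewrite inE /Z' (negbTE as_); case: eqP => [-> _|_ /= bs];
    last exact: sP.
  split=> //; apply: aW; exists [::] => //; exact: esym (big_nil _ _ _ _).
rewrite big_cons Z'E //; congr (_ + _).
by rewrite /Z' eqxx (negbTE as_) addr0.
Qed.

Lemma root_vector_span_bracket X Y :
  root_vector_span X -> root_vector_span Y ->
  root_vector_span (lie_bracket X Y).
Proof.
move=> XP YP; elim/root_vector_span_ind: X / XP => [|c M X [alpha Pa Ma] IHX].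
  by rewrite /lie_bracket mul0mx mulmx0 subrr; apply: root_vector_span0.
have -> : lie_bracket (c *: map_mx iKF M + X) Y
    = c *: lie_bracket (map_mx iKF M) Y + lie_bracket X Y.
  rewrite /lie_bracket mulmxDl mulmxDr scalerBr -scalemxAl -scalemxAr opprD.
  by rewrite addrACA.
apply: root_vector_spanD => //; apply: root_vector_spanZ.
elim/root_vector_span_ind: Y / YP {IHX} => [|d M' Y [beta Pb Mb] IHY].
  by rewrite /lie_bracket mul0mx mulmx0 subrr; apply: root_vector_span0.
have -> : lie_bracket (map_mx iKF M) (d *: map_mx iKF M' + Y)
    = d *: lie_bracket (map_mx iKF M) (map_mx iKF M')
      + lie_bracket (map_mx iKF M) Y.
  rewrite /lie_bracket mulmxDl mulmxDr scalerBr -scalemxAl -scalemxAr opprD.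
  by rewrite addrACA.
apply: root_vector_spanD => //; apply: root_vector_spanZ.
rewrite /lie_bracket -!map_mxM -map_mxB -/(lie_bracket M M').
have [->|MM0] := eqVneq (lie_bracket M M') 0.
  by rewrite map_mx0; apply: root_vector_span0.
apply: root_vector_span_gen.
have MME : map_mx iKR (lie_bracket M M')
    = lie_bracket (map_mx iKR M) (map_mx iKR M').
  by rewrite /lie_bracket map_mxB !map_mxM.
have MM0' : lie_bracket (map_mx iKR M) (map_mx iKR M') != 0.
  by rewrite -MME map_mx_eq0.
have [Pab ab] := root_space_bracket Pa Pb Ma Mb MM0'.
by exists (alpha + beta); rewrite // MME.
Qed.

(** A nonzero product of root vectors is an eigenvector of ad H for the sum of
    their heights, which is at least their number. *)
Lemma root_vector_prod0 : exists N, forall s : seq 'M[K]_n,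
  (forall M, M \in s -> rational_root_vector M) -> (N <= size s)%N ->
  \prod_(M <- s) M = 0.
Proof.
have [H hH] := height_exists; have [N hN] := ad_eigenvalue_bound (vsval H).
have key (s : seq 'M[K]_n) : (forall M, M \in s -> rational_root_vector M) ->
    exists2 h, (size s <= h)%N
      & lie_bracket (vsval H) (map_mx iKR (\prod_(M <- s) M))
      = h%:R *: map_mx iKR (\prod_(M <- s) M).
  elim: s => [|M s IH] sP.
    exists 0%N; rewrite // big_nil -[1]/(1%:M) map_scalar_mx rmorph1.
    by rewrite /lie_bracket mulmx1 mul1mx subrr scale0r.
  have [h sh hE] := IH (fun M' M's => sP M' (mem_behead (s := M :: s) M's)).
  have [alpha Pa [_ Ma]] := sP M (mem_head _ _); have [k k0 kE] := hH _ Pa.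
  exists (k + h)%N; first by rewrite /= -add1n leq_add.
  rewrite big_cons; set W := \prod_(M <- s) M in hE *.
  rewrite -[M * W]/(M *m W) map_mxM natrD scalerDl -kE.
  rewrite scalemxAl -Ma scalemxAr -hE /lie_bracket !(mulmxBl, mulmxBr) !mulmxA.
  by rewrite addrA subrK.
exists N => s sP Ns; have [h sh hE] := key s sP.
have := hN h _ (leq_trans Ns sh) hE => /eqP; rewrite map_mx_eq0 => /eqP //.
Qed.

(** The products over F reduce to products of K-rational root vectors by
    expanding the factors one after the other, from the left. *)
Lemma root_vector_span_prod0 : exists N, forall s : seq 'M[F]_n,
  (forall X, X \in s -> root_vector_span X) -> (N <= size s)%N ->
  \prod_(X <- s) X = 0.
Proof.
have [N hN] := root_vector_prod0; exists N => s sP Ns.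
suff key (r : seq 'M[K]_n) : (forall M, M \in r -> rational_root_vector M) ->
    (N <= size r + size s)%N ->
    map_mx iKF (\prod_(M <- r) M) * \prod_(X <- s) X = 0.
  have := key [::] _ Ns; rewrite big_nil [map_mx _ _](map_mx1 iKF) mul1r.
  by apply.
elim: s sP r {Ns} => [|X s IH] sP r rP /=.
  by rewrite addn0 => Nr; rewrite hN // map_mx0 mul0r.
move=> Nr; rewrite big_cons.
have XP := sP X (mem_head _ _).
have {}sP Y : Y \in s -> root_vector_span Y.
  by move=> Ys; apply: sP; rewrite inE Ys orbT.
elim/root_vector_span_ind: X / XP => [|c M X MP IHX].
  by rewrite mul0r mulr0.
rewrite mulrDl mulrDr IHX addr0.
have h := IH sP (rcons r M); rewrite size_rcons addSnnS big_rcons /= in h.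
have -> : map_mx iKF (\prod_(M0 <- r) M0)
      * (c *: map_mx iKF M * \prod_(j <- s) j)
    = c *: (map_mx iKF (\prod_(M0 <- r) M0 *m M) *m \prod_(j <- s) j).
  by rewrite map_mxM -[LHS]/(_ *m (_ *m _)) -scalemxAl -scalemxAr mulmxA.
rewrite [X in _ *: X]h ?scaler0 // => M'.
by rewrite mem_rcons inE => /predU1P[->//|]; exact: rP.
Qed.

End Nilradical.

(** * Conclusion *)

Lemma bch_sum_ev (L : numFieldType) n (X Y : 'M[L]_n) N B :
  bch_expression B -> bch_first_terms B -> B 0%N = [::] -> (3 < N)%N ->
  (forall w, (N < size w)%N -> word_mx X Y w = 0) ->
  bch_sum B X Y (ev X Y N bch).
Proof.
move=> BE [B1 B2 B3 B4] B0 N3 words0.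
have N0 : (0 < N)%N by apply: leq_trans N3.
exists N => [m Nm|].
  have := (proj1 BE) m; elim: (B m) => //= t s IH /andP[/eqP tm sm].
  by rewrite IH // (commutator_mx0 words0) ?eqxx ?tm.
rewrite (ev_bch words0 N0 BE).
rewrite -(big_mkord xpredT (fun m =>
  \sum_(t <- B m) ratr t.1 *: commutator_mx X Y t.2)).
do 5 (rewrite big_ltn; last by rewrite ?ltnS // (leq_trans _ N3)).
rewrite B0 B1 B2 B3 B4 !big_cons !big_nil !addr0 add0r /=.
rewrite rmorphN !fmorphV !rmorph_nat rmorph1 !scale1r /commutator_mx /=.
move: (lie_bracket X (lie_bracket X Y)) => M3.
move: (lie_bracket Y (lie_bracket Y X)) => M4.
move: (lie_bracket Y M3) (lie_bracket X Y) => M5 M2.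
by rewrite scalerDr scaleNr !addrA.
Qed.

Theorem proposition5p12
  (R : realType) (K F : rcfType) (D : closedFieldType)
  (iKR : {rmorphism K -> R}) (iKF : {rmorphism K -> F})
  (iRD : {rmorphism R -> D}) (iFD : {rmorphism F -> D}) (iKD : {rmorphism K -> D})
  (iKRD : forall x, iRD (iKR x) = iKD x) (iKFD : forall x, iFD (iKF x) = iKD x)
  (n : nat)
  (GD : set 'M[D]_n)
  (GD_group : linear_algebraic_group GD) (GD_ss : semisimple GD)
  (GD_K : defined_over iKD GD) (GD_adj : self_adjoint GD)
  (G : set 'M[K]_n)
  (G_group : matrix_group G) (G_sa : semialgebraic G)
  (G_ge : sa_identity_component (points iKD GD) `<=` G)
  (G_le : G `<=` points iKD GD)
  (SD : set 'M[D]_n)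
  (SD_max : maximal_split_torus iKD GD SD) (SD_adj : self_adjoint SD)
  (A : set 'M[K]_n) (A_def : A = sa_identity_component (points iKD SD))
  (g a : {vspace 'M[R]_n})
  (g_def : is_lie_algebra (sa_extension iKR G) g)
  (a_def : is_lie_algebra (sa_extension iKR A) a)
  (P : set (dual_space a)) (P_pos : positive_system (is_root g (a := a)) P)
  (nF : set 'M[F]_n) (nF_def : nF = nilradical_over g iKR iKF P)
  (UF : set 'M[F]_n) (UF_def : UF = [set nilp_exp X | X in nF]) :
  exists B : nat -> seq (rat * commutator),
    [/\ bch_expression B,
        bch_first_terms B,
        forall X Y, nF X -> nF Y ->
          exists Z, [/\ nF Z, nilp_exp X *m nilp_exp Y = nilp_exp Z
                      & bch_sum B X Y Z]
      & forall u v, UF u -> UF v ->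
          let X := unip_log u in
          let Y := unip_log v in
          let Z := unip_log (u *m v) in
          [/\ nF X /\ nF Y, nF Z, nilp_exp X *m nilp_exp Y = nilp_exp Z
            & bch_sum B X Y Z]].
Proof.
have [B [BE B1 B0]] := bch_expression_exists.
have g_bracket X Y : X \in g -> Y \in g -> lie_bracket X Y \in g.
  apply: is_lie_algebra_bracket g_def => x y z; exact: sa_extension_conj.
have nFE : nF = root_vector_span g iKR iKF P by rewrite nF_def nilradical_span.
have [N0 prod0] := root_vector_span_prod0 iKR iKF P_pos.
(* The explicit terms in [bch_sum] go up to degree 4. *)
pose N := maxn N0 4.
have N3 : (3 < N)%N by rewrite leq_max orbT.
have Npos : (0 < N)%N by apply: leq_trans N3.
have words0 X Y : nF X -> nF Y ->
    forall w, (N < size w)%N -> word_mx X Y w = 0.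
  rewrite nFE => XP YP w Nw; rewrite /word_mx -(big_map _ xpredT id).
  apply: prod0 => [M /mapP[[] _ ->] //|].
  by rewrite size_map ltnW // (leq_ltn_trans _ Nw) // leq_maxl.
have nF_bch X Y : nF X -> nF Y -> nF (ev X Y N bch).
  move=> Xn Yn; rewrite (ev_bch (words0 _ _ Xn Yn) Npos BE).
  move: Xn Yn; rewrite nFE => XP YP.
  elim/big_ind: _ => [||m _]; first exact: root_vector_span0.
    exact: root_vector_spanD.
  elim/big_ind: _ => [||t _]; first exact: root_vector_span0.
    exact: root_vector_spanD.
  apply: root_vector_spanZ; elim: t.2 => //= c IHc d IHd.
  exact: root_vector_span_bracket.
have log_exp X Y b : nF X -> nF Y ->
    unip_log (nilp_exp (letter_mx X Y b)) = letter_mx X Y b.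
  move=> Xn Yn; rewrite -(ev_var_pos X Y b Npos).
  by apply: (unip_log_exp (words0 _ _ Xn Yn)); apply: low_var.
exists B; split=> // [X Y Xn Yn|u v].
  exists (ev X Y N bch); split; first exact: nF_bch.
    exact: nilp_exp_bch (words0 _ _ Xn Yn) Npos.
  exact: bch_sum_ev (words0 _ _ Xn Yn).
rewrite UF_def => -[X Xn <-] [Y Yn <-] /=.
rewrite (log_exp X Y false Xn Yn) (log_exp X Y true Xn Yn).
have w0 := words0 _ _ Xn Yn.
have -> : unip_log (nilp_exp X *m nilp_exp Y) = ev X Y N bch.
  by rewrite (nilp_exp_bch w0 Npos); apply: (unip_log_exp w0); apply: bch_low.
split=> //; first exact: nF_bch.
  exact: nilp_exp_bch w0 Npos.
exact: bch_sum_ev w0.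
Qed.
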